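(* Let $\alpha$ be an ordinal and let $\langle X_n\xleftarrow{f_n}X_{n+1}:n<\omega\rangle$ be an inverse sequence of compacta in which each $f_n:X_{n+1}\to X_n$ is a map of level $\geq\alpha$. Let $X=\{\langle x_0,x_1,\dots\rangle\in\prod_n X_n:x_n=f_n(x_{n+1})\text{ for all }n\}$ be the inverse limit, with projections $g_n:X\to X_n$. Then each $g_n$ is a map of level $\geq\alpha$.
   Context: A compactum is a compact Hausdorff space. For a compactum $X$ and an ultrafilter $\mathcal{D}$ on a set $I$, the ultracopower $XI\backslash\mathcal{D}$ is the subspace of $\beta(X\times I)$ ($I$ discrete) of points mapped to $\mathcal{D}\in\beta(I)$ by the Stone–Čech extension of the projection to $I$; the codiagonal $p_{X,\mathcal{D}}:XI\backslash\mathcal{D}\to X$ is the restriction of the Stone–Čech extension of the projection $X\times I\to X$. A continuous map $f:X\to Y$ is co-elementary if there are ultrafilters $\mathcal{D}$ on $I$, $\mathcal{E}$ on $J$ and a homeomorphism $h:XI\backslash\mathcal{D}\to YJ\backslash\mathcal{E}$ with $f\circ p_{X,\mathcal{D}}=p_{Y,\mathcal{E}}\circ h$. Levels: a function $f:X\to Y$ between compacta is of level $\geq0$ iff it is a continuous surjection; of level $\geq\alpha+1$ iff there are a compactum $Z$, a co-elementary map $g:Z\to Y$ and a map $h:Z\to X$ of level $\geq\alpha$ with $g=f\circ h$; for a limit ordinal $\lambda>0$, of level $\geq\lambda$ iff of level $\geq\alpha$ for all $\alpha<\lambda$. *)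

(* Defs.v *)
From mathcomp Require Import all_boot all_order all_algebra.
From mathcomp Require Import all_classical all_reals.
From mathcomp Require wochoice.
From mathcomp Require Import topology normedtype.
Import numFieldNormedType.Exports.
Import Order.TTheory GRing.Theory Num.Theory.

Set SsrOldRewriteGoalsOrder.
Set Implicit Arguments.
Unset Strict Implicit.
Unset Printing Implicit Defensive.

Local Open Scope classical_set_scope.
Local Open Scope ring_scope.

Definition compactum (T : topologicalType) : Prop :=
  compact [set: T] /\ hausdorff_space T.

Definition homeomorphism (S T : topologicalType) (h : S -> T) : Prop :=
  continuous h /\ exists2 k : T -> S, continuous k & cancel h k /\ cancel k h.

Definition unit_itv (R : realType) : topologicalType :=
  set_type [set` `[0%R : R, 1%R]].

Definition cube (R : realType) (T : topologicalType) : topologicalType :=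
  {ptws continuousType T (unit_itv R) -> unit_itv R}.

Definition cube_eval (R : realType) (T : topologicalType) (t : T) : cube R T :=
  fun phi => phi t.

Arguments cube_eval R {T} t.

(* The Stone-Cech compactification [beta R T] is the closure of the image of
   [T] in the cube [0,1]^C(T,[0,1]).  This makes sense for every topological
   space, and [beta_unit] is an embedding when [T] is Tychonoff. *)
Definition beta (R : realType) (T : topologicalType) : topologicalType :=
  set_type (closure (range (@cube_eval R T))).

Definition beta_unit (R : realType) (T : topologicalType) (t : T) : beta R T :=
  SigSub (mem_set (subset_closure (imageT (@cube_eval R T) t))).

Lemma beta_inhabited (R : realType) (T : topologicalType) (p : beta R T) :
  exists t : T, True.
Proof.
have /set_mem/(_ setT) := valP p.
by case; [exact: filterT|move=> _ [[t _ _] _]; exists t].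
Qed.

(* The Stone-Cech extension of [f : T -> K].  By [beta_ext_spec] and
   [beta_ext_uniq], it is the unique continuous function on [beta R T] that
   extends [f] when [f] is continuous and [K] is a compactum; the default value
   of [xget] only serves to make it total. *)
Definition beta_ext (R : realType) (T K : topologicalType) (f : T -> K) :
    beta R T -> K :=
  xget (fun p => f (sval (cid (beta_inhabited p))))
       [set F : beta R T -> K | continuous F /\ F \o @beta_unit R T = f].

(* The extension of the projection to [I] has values in [beta R I].  An
   ultrafilter [D] on [I], seen as a point of the Stone-Cech compactification,
   is the unique point to which [D] converges along [beta_unit]. *)
Definition ultracopower (R : realType) (X : topologicalType)
    (I : discreteTopologicalType) (D : set_system I) : set (beta R (X * I)%type) :=
  [set p | @beta_unit R I @ D -->
           beta_ext (fun xi : X * I => beta_unit R xi.2) p].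

Definition codiagonal (R : realType) (X : topologicalType)
    (I : discreteTopologicalType) (D : set_system I)
    (p : set_type (@ultracopower R X I D)) : X :=
  beta_ext (fun xi : X * I => xi.1) (set_val p).

Definition coelementary (R : realType) (X Y : topologicalType) (f : X -> Y) :
    Prop :=
  continuous f /\
  exists (I J : discreteTopologicalType) (D : set_system I) (E : set_system J)
         (h : set_type (@ultracopower R X I D) ->
              set_type (@ultracopower R Y J E)),
    [/\ UltraFilter D, UltraFilter E, homeomorphism h &
        f \o @codiagonal R X I D = @codiagonal R Y J E \o h].

(* Ordinals are represented by the elements of a well-ordered type. *)

Section ordinals.
Context {d : Order.disp_t} {W : orderType d}.

Definition is_zero (a : W) : Prop := forall b : W, (a <= b)%O.

Definition is_succ (a b : W) : Prop :=
  (a < b)%O /\ forall c : W, (a < c)%O -> (b <= c)%O.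

Definition is_limit (l : W) : Prop :=
  ~ is_zero l /\ forall a : W, ~ is_succ a l.

End ordinals.

(* [level_ge R a f] is well behaved when the order of [W] is a well-order: the
   three cases on [a] are then exclusive and exhaustive, and the recursion is
   well-founded. *)
Inductive level_ge (R : realType) (d : Order.disp_t) (W : orderType d) (b : W)
    (X Y : topologicalType) (f : X -> Y) : Prop :=
| level_ge_zero of is_zero b & compactum X & compactum Y
    & continuous f & range f = [set: Y]
| level_ge_succ (a : W) (Z : topologicalType) (g : Z -> Y) (h : Z -> X)
    of is_succ a b & compactum X & compactum Y & compactum Z
    & coelementary R g & level_ge R a h & g = f \o h
| level_ge_limit of is_limit b & (forall a : W, (a < b)%O -> level_ge R a f).

Definition inverse_limit (X : nat -> topologicalType)
    (f : forall n, X n.+1 -> X n) : set (prod_topology X) :=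
  [set x | forall n, x n = f n (x n.+1)].

Definition inverse_limit_proj (X : nat -> topologicalType)
    (f : forall n, X n.+1 -> X n) (n : nat)
    (x : set_type (inverse_limit f)) : X n :=
  set_val x n.

Section facts.
Import ArrowAsProduct.

Lemma set_val_continuous (T : topologicalType) (A : set T) :
  continuous (set_val : set_type A -> T).
Proof. exact: initial_continuous. Qed.

Lemma set_type_hausdorff (T : topologicalType) (A : set T) :
  hausdorff_space T -> hausdorff_space (set_type A).
Proof.
move=> hT p q pq; apply: val_inj; apply: hT => U V pU qV.
have := pq _ _ (set_val_continuous pU) (set_val_continuous qV).
by case=> r [Ur Vr]; exists (set_val r).
Qed.

Lemma set_type_compact (T : topologicalType) (A : set T) :
  compact A -> compact [set: set_type A].
Proof.
move=> cA F PF _.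
have [|p [Ap clp]] := cA (set_val @ F).
  by apply: (@filterS _ F _ setT) => [x _ /=|]; [exact: set_valP|exact: filterT].
exists (SigSub (mem_set Ap)); split => // B C FB [_ [[V oV <-] Vp VC]].
have [||r [[x Bx <-] Vx]] := clp (set_val @` B) V.
- by apply: (@filterS _ F _ B) => // x Bx; exists x.
- by apply: open_nbhs_nbhs; split.
by exists x; split => //; exact: VC.
Qed.

Lemma unit_itv_compactum (R : realType) : compactum (unit_itv R).
Proof.
split; first exact/set_type_compact/segment_compact.
exact/set_type_hausdorff/Rhausdorff.
Qed.

Lemma cube_compactum (R : realType) (T : topologicalType) :
  compactum (cube R T).
Proof.
split; last by apply: hausdorff_product => _; exact: (unit_itv_compactum R).2.
have -> : [set: cube R T] = [set f | forall i, [set: unit_itv R] (f i)].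
  by apply/seteqP; split.
by apply: (@tychonoff _ (fun=> unit_itv R) (fun=> setT)) => i;
   exact: (unit_itv_compactum R).1.
Qed.

Lemma beta_compactum (R : realType) (T : topologicalType) :
  compactum (beta R T).
Proof.
split; last exact/set_type_hausdorff/(cube_compactum R T).2.
apply: set_type_compact; apply: subclosed_compact (cube_compactum R T).1 _ => //.
exact: closed_closure.
Qed.

Lemma continuous_in_cube (R : realType) (S T : topologicalType)
    (g : S -> cube R T) :
  (forall phi, continuous (fun s => g s phi)) -> continuous g.
Proof.
move=> cg s; apply/cvg_sup => phi U [_ [[V oV <-] Vs VU]].
rewrite /= nbhs_simpl; apply: (@filterS _ (nbhs s) _ _ _ _ (cg phi s V _)).
  by move=> t Vt; exact: VU.
by apply: open_nbhs_nbhs; split.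
Qed.

Lemma cube_eval_continuous (R : realType) (T : topologicalType) :
  continuous (@cube_eval R T).
Proof. by apply: continuous_in_cube => phi; exact: cts_fun. Qed.

Lemma beta_unit_continuous (R : realType) (T : topologicalType) :
  continuous (@beta_unit R T).
Proof.
move=> t U [_ [[V oV <-] Vt VU]].
apply: (@filterS _ (nbhs t) _ _ _ _ (@cube_eval_continuous R T t V _)).
  by move=> s Vs; exact: VU.
by apply: open_nbhs_nbhs; split.
Qed.

Lemma beta_ext_uniq (R : realType) (T K : topologicalType)
    (F G : beta R T -> K) :
  hausdorff_space K -> continuous F -> continuous G ->
  F \o @beta_unit R T = G \o @beta_unit R T -> F = G.
Proof.
move=> hK cF cG FG; apply/funext => p; apply: hK => A B FpA GpB.
have FGAB : nbhs p (F @^-1` A `&` G @^-1` B).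
  by apply: filterI; [exact: cF|exact: cG].
have [_ [[V oV <-] Vp VAB]] := FGAB.
have /set_mem/(_ V) := valP p.
case; first by apply: open_nbhs_nbhs; split.
move=> _ [[t _ <-] Vt]; exists (F (beta_unit R t)).
have [At Bt] := VAB (beta_unit R t) Vt; split => //.
by have /= -> := congr1 (@^~ t) FG.
Qed.

Lemma cube_eval_inj (R : realType) (K : topologicalType) :
  compactum K -> injective (@cube_eval R K).
Proof.
move=> [cK hK] x y xy; apply: contrapT => xNy.
have nK := compact_normal hK cK.
have sep : uniform_separator [set x] [set y].
  move: nK => /normal_separatorP; apply.
  - exact: R.
  - exact/accessible_closed_set1/hausdorff_accessible.
  - exact/accessible_closed_set1/hausdorff_accessible.
  - by apply/seteqP; split => // z [-> /xNy].
have [f [cf f01 f0 f1]] := (@uniform_separatorP K R _ _).1 sep.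
have f01' t : f t \in [set` `[0%R : R, 1%R]] by apply/mem_set/f01; exists t.
pose g t : unit_itv R := SigSub (f01' t).
have cg : continuous g.
  move=> t U [_ [[V oV <-] Vt VU]].
  apply: (@filterS _ (nbhs t) _ _ _ _ (cf t V _)).
    by move=> s Vs; exact: VU.
  by apply: open_nbhs_nbhs; split.
have /(congr1 set_val) := congr1 (@^~ (mkcts cg : continuousType _ _)) xy.
rewrite /= [LHS](_ : _ = f x)// [RHS](_ : _ = f y)//.
have -> : f x = 0 by apply: f0; exists x.
have -> : f y = 1 by apply: f1; exists y.
by move=> /eqP; rewrite eq_sym oner_eq0.
Qed.

Lemma beta_ext_spec (R : realType) (T K : topologicalType) (f : T -> K) :
  compactum K -> continuous f ->
  continuous (@beta_ext R T K f) /\ @beta_ext R T K f \o @beta_unit R T = f.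
Proof.
move=> kK cf.
suff exF : exists F : beta R T -> K, continuous F /\ F \o @beta_unit R T = f.
  exact: (xgetPex _ exF).
have hC := (cube_compactum R K).2.
have im_closed (C : set K) : closed C -> closed (@cube_eval R K @` C).
  move=> cC; apply: compact_closed => //; apply: continuous_compact.
    exact/continuous_subspaceT/cube_eval_continuous.
  exact: subclosed_compact cC kK.1 _.
pose pull (phi : continuousType K (unit_itv R)) : continuousType T (unit_itv R) :=
  mkcts (fun t => continuous_comp (cf t) (@cts_fun _ _ phi (f t))).
pose bf (p : beta R T) : cube R K := fun phi => set_val p (pull phi).
have cbf : continuous bf.
  apply: continuous_in_cube => phi p.
  apply: (@continuous_comp _ (cube R T) _ set_val (@^~ (pull phi))).
    exact: set_val_continuous.
  exact: (@proj_continuous _ (fun=> unit_itv R) (pull phi)).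
have bfE t : bf (beta_unit R t) = cube_eval R (f t) by [].
have bf_im p : range (@cube_eval R K) (bf p).
  have cl : closed (bf @^-1` range (@cube_eval R K)).
    exact: ((continuous_closedP bf).1 cbf _ (im_closed setT _)).
  apply: cl => U [_ [[V oV <-] Vp VU]].
  have /set_mem/(_ V) := valP p.
  case; first by apply: open_nbhs_nbhs; split.
  move=> _ [[t _ <-] Vt]; exists (beta_unit R t); split; last exact: VU.
  by exists (f t).
have [F FE] : {F : beta R T -> K | forall p, cube_eval R (F p) = bf p}.
  by exists (fun p => s2val (cid2 (bf_im p))) => p; case: cid2.
exists F; split; last first.
  by apply/funext => t; apply: (cube_eval_inj (R := R) kK); rewrite /= FE bfE.
apply/continuous_closedP => C cC.
rewrite (_ : F @^-1` C = bf @^-1` (@cube_eval R K @` C)).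
  exact: ((continuous_closedP bf).1 cbf _ (im_closed C cC)).
apply/seteqP; split => p /=; first by move=> CFp; exists (F p).
by move=> [k Ck]; rewrite -FE => /(cube_eval_inj kK) <-.
Qed.

End facts.

(* Main.v *)
Require Import Defs.
From mathcomp Require Import all_boot all_order all_algebra.
From mathcomp Require Import all_classical all_reals.
From mathcomp Require wochoice.
From mathcomp Require Import topology normedtype numfun.
Import numFieldNormedType.Exports.
Import Order.TTheory GRing.Theory Num.Theory.
Set SsrOldRewriteGoalsOrder.
Set Implicit Arguments.
Unset Strict Implicit.
Unset Printing Implicit Defensive.
Local Open Scope classical_set_scope.
Local Open Scope ring_scope.

(* Every ultracopower is a quotient of a space of ultrafilters, and maps of
   index sets induce maps of ultracopowers; this replaces model theory.

   The key fact is that if [phi : I -> J] maps the ultrafilter [D] onto [E],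
   then the induced map from the ultracopower of [X] along [D] to the one along
   [E] has every level.  For a suitable ultrafilter [H] on the set of sections
   [s] of [phi], evaluation [(s, j) |-> s j] maps [H (x) E] to [D], and the map
   induced by this evaluation factors the codiagonal of the ultracopower
   along [E] with respect to [H]; it is again of the same form, so one can
   iterate.  Hence, by simultaneous induction, ultracoproducts and composites
   of maps of level [>= b] have level [>= b].

   For an inverse sequence with limit [L] and maps of level [>= b], let [a < b]
   and let [E] be a nonprincipal ultrafilter on [nat].  Each composite
   [X_(k+n+1) -> X_n] gives an ultracopower [Q_k] of [X_n] and a map
   [Q_k -> X_(k+n+1)] of level [>= a].  Let [Z] and [Q] be the ultracoproducts
   along [E] of the [X_(k+n+1)] and the [Q_k].  There is a natural map
   [v : Z -> L], and the codiagonal of the ultracopower of [L] along [E] factors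
   through [v] via a map to [Z] which has level [>= a] by induction, so [v] has
   level [>= a].  Then [Q -> Z -> L] has level [>= a], and [Q] is an
   ultracopower of [X_n]. *)

(** * Ultrafilters and compacta *)

Lemma choice_dep (I : Type) (T : I -> Type) (P : forall i, T i -> Prop) :
  (forall i, exists x, P i x) -> exists f : forall i, T i, forall i, P i (f i).
Proof. by move=> h; exists (fun i => sval (cid (h i))) => i; case: cid. Qed.

Lemma ultra_dichotomy (T : Type) (F : set_system T) :
  ProperFilter F -> (forall A, F A \/ F (~` A)) -> UltraFilter F.
Proof.
move=> PF dF; split=> // G PG FG; apply/seteqP; split=> // A GA.
have [//|/FG GnA] := dF A.
by have [x []] := filter_ex (filterI GA GnA).
Qed.

Lemma ultra_fmap (S T : Type) (f : S -> T) (U : set_system S) :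
  UltraFilter U -> UltraFilter (f @ U).
Proof.
move=> UU; apply: ultra_dichotomy => A.
exact: (in_ultra_setVsetC (f @^-1` A) UU).
Qed.

Lemma ultra_meet (T : Type) (F G : set_system T) :
  Filter F -> Filter G -> (forall A B, F A -> G B -> A `&` B !=set0) ->
  exists U, [/\ UltraFilter U, F `<=` U & G `<=` U].
Proof.
move=> FF FG FGm.
pose H : set_system T := [set C | exists A B, [/\ F A, G B & A `&` B `<=` C]].
have PH : ProperFilter H.
  apply: Build_ProperFilter_ex => [C [A [B [FA GB AB]]]|].
    by have [x /AB] := FGm _ _ FA GB; exists x.
  split.
  - by exists setT, setT; split=> //; exact: filterT.
  - move=> C1 C2 [A1 [B1 [FA1 GB1 AB1]]] [A2 [B2 [FA2 GB2 AB2]]].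
    exists (A1 `&` A2), (B1 `&` B2); split; [exact: filterI|exact: filterI|].
    by rewrite setIACA => x [/AB1 ? /AB2].
  - move=> C1 C2 C12 [A [B [FA GB AB]]]; exists A, B; split=> //.
    exact: subset_trans C12.
have [U [UU HU]] := ultraFilterLemma PH.
exists U; split=> // A ?; apply: HU.
- by exists A, setT; split; [done|exact: filterT|move=> x []].
- by exists setT, A; split; [exact: filterT|done|move=> x []].
Qed.

Lemma preimage_filter (S T : Type) (f : S -> T) (D : set_system T) :
  Filter D -> Filter (filter_from D (fun A => f @^-1` A)).
Proof.
move=> FD; apply: filter_from_filter; first by exists setT; exact: filterT.
by move=> A B DA DB; exists (A `&` B) => //; exact: filterI.
Qed.

(** The sets of [G] and the preimages of sets of [U] generate a proper filter. An ultrafilter [V]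
    above it has an image containing [U], hence equal to [U] by maximality. *)
Lemma ultra_lift (S T : Type) (f : S -> T) (U : set_system T)
    (G : set_system S) : UltraFilter U -> Filter G ->
  (forall A B, U A -> G B -> f @^-1` A `&` B !=set0) ->
  exists V, [/\ UltraFilter V, G `<=` V & f @ V = U].
Proof.
move=> UU FG UG.
have FF : Filter (filter_from U (fun A => f @^-1` A))
  by exact: preimage_filter.
have [|V [UV FV GV]] := ultra_meet FF FG.
  by move=> A B [C UC CA] /(UG _ _ UC)[x [/CA ? ?]]; exists x.
exists V; split=> //; apply: max_filter => A UA; apply: FV.
by exists A.
Qed.

Lemma ultra_sub_eq (T : Type) (U V : set_system T) :
  UltraFilter U -> UltraFilter V -> U `<=` V -> V = U.
Proof. by move=> UU UV; exact: max_filter. Qed.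

Section bind.
Context (S T : Type) (V : set_system S) (u : S -> set_system T).

(** The Kleisli extension of the ultrafilter monad: the sum of the [u s] along [V]. *)
Definition bind_ultra : set_system T := [set A | V [set s | u s A]].

Lemma bind_ultraP : UltraFilter V -> (forall s, UltraFilter (u s)) ->
  UltraFilter bind_ultra.
Proof.
move=> UV Uu; apply: ultra_dichotomy => [|A]; last first.
  have [?|VnA] := in_ultra_setVsetC [set s | u s A] UV; [by left|right].
  apply: filterS VnA => s /= nusA.
  by have [] := in_ultra_setVsetC A (Uu s).
apply: Build_ProperFilter_ex => [A VA|].
  have [s /= usA] := @filter_ex _ V _ _ VA.
  by have := Uu s => ?; exact: (filter_ex usA).
split.
- apply: (@filterS _ V _ _ _ _ (@filterT _ V _)) => s _.
  by have := Uu s => ?; exact: filterT.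
- move=> A B VA VB; apply: (@filterS _ V _ _ _ _ (@filterI _ V _ _ _ VA VB)) => s [] /=.
  by have := Uu s => ?; exact: filterI.
- by move=> A B AB; apply: (@filterS _ V) => s /=; have := Uu s => ?; exact: filterS.
Qed.

End bind.

Section compacta.
Context (R : realType).
Implicit Types K S : topologicalType.

(** Equalities between points of compacta are reduced to maps into the interval, the only maps that
    [ucp_lift] represents by families. *)
Lemma compactum_ext K (x y : K) : compactum K ->
  (forall phi : K -> unit_itv R, continuous phi -> phi x = phi y) -> x = y.
Proof.
move=> cK xy; apply: (@cube_eval_inj R K cK); apply/funext => phi.
exact: (xy phi (@cts_fun _ _ phi)).
Qed.

Lemma compactum_continuous K S (F : S -> K) : compactum K ->
  (forall phi : K -> unit_itv R, continuous phi -> continuous (phi \o F)) ->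
  continuous F.
Proof.
move=> cK cF; apply/continuous_closedP => C cC.
have im_closed : closed (@cube_eval R K @` C).
  apply: compact_closed; first exact: (cube_compactum R K).2.
  apply: continuous_compact; last exact: subclosed_compact cC cK.1 _.
  exact/continuous_subspaceT/cube_eval_continuous.
have ceF : continuous (@cube_eval R K \o F).
  by apply: continuous_in_cube => phi; exact: (cF phi (@cts_fun _ _ phi)).
rewrite (_ : F @^-1` C = (@cube_eval R K \o F) @^-1` (@cube_eval R K @` C)).
  exact: ((continuous_closedP _).1 ceF _ im_closed).
apply/seteqP; split => s /=; first by move=> CFs; exists (F s).
by move=> [k Ck] /(cube_eval_inj cK) <-.
Qed.

Lemma compactum_ultra_cvg K (U : set_system K) : compactum K ->
  UltraFilter U -> exists k : K, U --> k.
Proof.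
move=> [cK _] UU; have := cK; rewrite compact_ultra => /(_ U UU filterT).
by case=> k [_ ?]; exists k.
Qed.

Lemma compactum_separated K (A : set K) (k : K) : compactum K ->
  closed A -> ~ A k ->
  exists (phi : K -> unit_itv R) (O P : set (unit_itv R)),
    [/\ continuous phi, open O, open P, O `&` P = set0 &
        P (phi k) /\ forall a, A a -> O (phi a)].
Proof.
move=> [cK hK] cA nAk.
have nK := compact_normal hK cK.
have sep : uniform_separator [set k] A.
  move: nK => /normal_separatorP; apply.
  - exact: R.
  - exact/accessible_closed_set1/hausdorff_accessible.
  - exact: cA.
  - by apply/seteqP; split => // z [-> /nAk].
have [f [cf f01 f0 f1]] := (@uniform_separatorP K R _ _).1 sep.
have f01' t : f t \in [set` `[0%R : R, 1%R]] by apply/mem_set/f01; exists t.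
pose g t : unit_itv R := SigSub (f01' t).
have cg : continuous g.
  move=> t U [_ [[V oV <-] Vt VU]].
  apply: (@filterS _ (nbhs t) _ _ _ _ (cf t V _)).
    by move=> s Vs; exact: VU.
  by apply: open_nbhs_nbhs; split.
(* The Urysohn function is constantly 1 on [A], so a neighbourhood of one value suffices for [O];
   for empty [A], [O] is empty. *)
have [[a Aa]|An0] := pselect (A !=set0); last first.
  exists g, set0, setT; split=> //; [exact: open0|exact: openT|by rewrite set0I|].
  by split=> // a Aa; case: An0; exists a.
have : g k != g a.
  apply/eqP => /(congr1 set_val) /=.
  rewrite [LHS](_ : _ = f k)// [RHS](_ : _ = f a)//.
  have -> : f k = 0%R by apply: f0; exists k.
  have -> : f a = 1%R by apply: f1; exists a.
  by move/eqP; rewrite eq_sym oner_eq0.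
have := (unit_itv_compactum R).2; rewrite open_hausdorff => /[apply].
move=> [[P O] [/set_mem Pk /set_mem Oa] [oP oO /eqP PO]].
exists g, O, P; split=> //; first by rewrite setIC.
split=> // b Ab; suff -> : g b = g a by [].
have fA x : A x -> f x = 1 by move=> Ax; apply: f1; exists x.
by apply: val_inj; exact: etrans (fA b Ab) (esym (fA a Aa)).
Qed.

End compacta.

Lemma compactum_range_closed (S K : topologicalType) (F : S -> K) :
  compactum S -> compactum K -> continuous F -> closed (range F).
Proof.
move=> [cS _] [_ hK] cF; apply: compact_closed => //.
by apply: continuous_compact => //; exact/continuous_subspaceT.
Qed.

Lemma cvg_continuous_comp (T : Type) (S K : topologicalType) (U : set_system T)
    (F : S -> K) (c : T -> S) (s : S) :
  Filter U -> continuous F -> c @ U --> s -> F \o c @ U --> F s.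
Proof.
by move=> FU cF cs; exact: cvg_trans (cvg_app _ cs) (cF s).
Qed.

(** * Ultracoproducts *)

Definition fibrewise_continuous (I : Type) (X : I -> topologicalType)
    (K : topologicalType) (c : {i & X i} -> K) :=
  forall i, continuous (fun x : X i => c (existT _ i x)).

(** When [D] is an ultrafilter, the inclusion already forces the image of [U] under [projT1] to be
    [D]. *)
Definition lies_over (I : Type) (X : I -> Type) (D : set_system I)
    (U : set_system {i & X i}) :=
  UltraFilter U /\ forall A, D A -> U [set t | A (projT1 t)].

Definition represents (I : Type) (X : I -> topologicalType)
    (Z K : topologicalType) (rel : set_system {i & X i} -> Z -> Prop)
    (c : {i & X i} -> K) (C : Z -> K) :=
  forall U z, rel U z -> c @ U --> C z.

(* [Z] is characterized as the ultracoproduct of the [X i] along [D] up to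
   homeomorphism, without a choice of model: [rel U z] reads "[U], an
   ultrafilter on the disjoint union that lies over [D], converges to [z]".
   Ultrafilters rather than families of points are used so that empty [X i]
   need no special treatment. *)
Record ultracoproduct (R : realType) (I : Type) (D : set_system I)
    (X : I -> topologicalType) (Z : topologicalType)
    (rel : set_system {i & X i} -> Z -> Prop) : Prop := Ultracoproduct {
  ucp_compactum : compactum Z;
  ucp_over : forall U z, rel U z -> lies_over D U;
  ucp_ex : forall z, exists U, rel U z;
  ucp_pt : forall U, lies_over D U -> exists z, rel U z;
  ucp_lim : forall (K : topologicalType) (c : {i & X i} -> K),
    compactum K -> fibrewise_continuous c ->
    exists2 C : Z -> K, continuous C & represents rel c C;
  ucp_lift : forall C : Z -> unit_itv R, continuous C ->
    exists2 c, fibrewise_continuous c & represents rel c C }.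

Lemma lies_over_meet (I : Type) (X : I -> Type) (D : set_system I)
    (S : set {i & X i}) : Filter D ->
  (forall A, D A -> exists2 t, S t & A (projT1 t)) ->
  exists2 U, lies_over D U & U S.
Proof.
move=> FD DS.
have FF : Filter (filter_from D (preimage (@projT1 I X))).
  exact: preimage_filter.
have [|U [UU FU SU]] := @ultra_meet _ _ (globally S) FF (globally_filter _).
  by move=> A B [C DC CA] SB; have [t St Ct] := DS _ DC; exists t; split;
    [exact: CA|exact: SB].
exists U; last exact: SU.
by split=> // A DA; apply: FU; exists A.
Qed.

Section ultracoproducts.
Context (R : realType) (I : Type) (D : set_system I).
Context (X : I -> topologicalType) (Z : topologicalType).
Context (rel : set_system {i & X i} -> Z -> Prop).
Hypothesis uZ : ultracoproduct R D rel.

Lemma represents_inj (K : topologicalType) (c : {i & X i} -> K) (C C' : Z -> K) :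
  hausdorff_space K -> represents rel c C -> represents rel c C' -> C = C'.
Proof.
move=> hK cC cC'; apply/funext => z; have [U Uz] := ucp_ex uZ z.
have [UU _] := ucp_over uZ Uz.
exact: (cvg_unique hK (cC _ _ Uz) (cC' _ _ Uz)).
Qed.

Lemma represents_comp (K L : topologicalType) (c : {i & X i} -> K) (C : Z -> K)
    (phi : K -> L) :
  continuous phi -> represents rel c C -> represents rel (phi \o c) (phi \o C).
Proof.
move=> cphi cC U z Uz; have [UU _] := ucp_over uZ Uz.
by apply: cvg_continuous_comp => //; exact: cC.
Qed.

Lemma represents_continuous (K : topologicalType) (c : {i & X i} -> K)
    (C : Z -> K) :
  compactum K -> fibrewise_continuous c -> represents rel c C -> continuous C.
Proof.
move=> cK cc cC; have [C' cC' C'c] := ucp_lim uZ cK cc.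
by rewrite (represents_inj cK.2 cC C'c).
Qed.

(** A map from [Z] to the interval is represented by a family, so its value at a limit of [U]
    depends on [U] alone; such maps separate points. *)
Lemma ucp_rel_inj U z z' : rel U z -> rel U z' -> z = z'.
Proof.
move=> Uz Uz'; have [UU _] := ucp_over uZ Uz.
apply: (compactum_ext (R := R) (ucp_compactum uZ)) => C cC.
have [c _ cC'] := ucp_lift uZ cC.
exact: (cvg_unique (unit_itv_compactum R).2 (cC' _ _ Uz) (cC' _ _ Uz')).
Qed.

(** Otherwise almost every fibre contains a point outside the preimage of [O]. An ultrafilter over
    [D] carried by such points has a limit [z] with [C z] outside [O], a contradiction. *)
Lemma represents_open (K : topologicalType) (c : {i & X i} -> K) (C : Z -> K)
    (O : set K) : UltraFilter D -> represents rel c C -> open O ->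
  (forall z, O (C z)) -> D [set i | forall x, O (c (existT _ i x))].
Proof.
move=> UD cC oO CO.
have [//|DnO] := in_ultra_setVsetC [set i | forall x, O (c (existT _ i x))] UD.
have [|U oU UnO] := @lies_over_meet I X D [set t | ~ O (c t)] _.
  move=> A DA; have [i [/= nO Ai]] := filter_ex (filterI DnO DA).
  by have /existsNP[x ?] := nO; exists (existT _ i x).
have [z Uz] := ucp_pt uZ oU; have UU := oU.1.
have UO : U [set t | O (c t)].
  by apply: (cC _ _ Uz); apply: open_nbhs_nbhs; split.
by have [t []] := filter_ex (filterI UnO UO).
Qed.

End ultracoproducts.

(** * Maps of disjoint unions induce maps of ultracoproducts *)

Section ultracoproduct_map.
Context (R : realType).
Context (I : Type) (D : set_system I) (X : I -> topologicalType).
Context (Z : topologicalType) (rel : set_system {i & X i} -> Z -> Prop).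
Context (J : Type) (E : set_system J) (Y : J -> topologicalType).
Context (W : topologicalType) (rel' : set_system {j & Y j} -> W -> Prop).
Hypotheses (uZ : ultracoproduct R D rel) (uW : ultracoproduct R E rel').
Variable f : {i & X i} -> {j & Y j}.
Hypothesis f_cont : forall (K : topologicalType) (c : {j & Y j} -> K),
  fibrewise_continuous c -> fibrewise_continuous (c \o f).
Hypothesis f_over : forall B, E B ->
  D [set i | forall x, B (projT1 (f (existT _ i x)))].

Lemma lies_over_fmap (U : set_system {i & X i}) :
  lies_over D U -> lies_over E (f @ U).
Proof.
move=> [UU DU]; split; first exact: ultra_fmap.
by move=> B /f_over/DU; apply: (@filterS _ U) => -[i x] /= Bf; exact: Bf.
Qed.

(** [F z] is a limit of [f @ U] for some [U] converging to [z]. Continuity and independence of [U]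
    are tested on maps [C] to the interval: if [c] represents [C], then [c \o f] represents
    [C \o F]. *)
Lemma ultracoproduct_map : exists2 F : Z -> W, continuous F &
  forall U z, rel U z -> rel' (f @ U) (F z).
Proof.
have /choice[F FE] : forall z, exists w, exists2 U, rel U z & rel' (f @ U) w.
  move=> z; have [U Uz] := ucp_ex uZ z.
  have [w fUw] := ucp_pt uW (lies_over_fmap (ucp_over uZ Uz)).
  by exists w, U.
have Frep (C : W -> unit_itv R) : continuous C ->
    exists2 c, fibrewise_continuous c /\ represents rel' c C &
      continuous (C \o F) /\ represents rel (c \o f) (C \o F).
  move=> cC; have [c cc cC'] := ucp_lift uW cC.
  have [C0 cC0 C0c] := ucp_lim uZ (unit_itv_compactum R) (f_cont cc).
  suff CF : C \o F = C0 by exists c => //; rewrite CF.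
  apply/funext => z; have [U Uz fUw] := FE z.
  have [UU _] := ucp_over uZ Uz.
  exact: (cvg_unique (unit_itv_compactum R).2 (cC' _ _ fUw) (C0c _ _ Uz)).
exists F.
  by apply: (compactum_continuous (R := R) (ucp_compactum uW)) => C /Frep[c _ []].
move=> U z Uz; have oU := ucp_over uZ Uz.
have [w fUw] := ucp_pt uW (lies_over_fmap oU).
suff -> : F z = w by [].
apply: (compactum_ext (R := R) (ucp_compactum uW)) => C cC.
have [c [cc cC'] [_ cf]] := Frep C cC; have UU := oU.1.
exact: (cvg_unique (unit_itv_compactum R).2 (cf _ _ Uz) (cC' _ _ fUw)).
Qed.

(** By the last hypothesis an ultrafilter converging to [w] lifts along [f] to one lying over [D],
    and a limit of the lift is sent to [w]. *)
Lemma ultracoproduct_map_surj (F : Z -> W) : Filter D ->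
  (forall U z, rel U z -> rel' (f @ U) (F z)) ->
  (forall A, D A -> exists2 B, E B &
     forall s, B (projT1 s) -> exists2 t, f t = s & A (projT1 t)) ->
  range F = [set: W].
Proof.
move=> FD Fr fs; apply/seteqP; split=> // w _; have [V Vw] := ucp_ex uW w.
have [UV EV] := ucp_over uW Vw.
have FG : Filter (filter_from D (preimage (@projT1 I X))).
  exact: preimage_filter.
have [|U [UU DU fU]] := @ultra_lift _ _ f V _ UV FG.
  move=> B' A' VB' [A DA AA']; have [B EB BA] := fs _ DA.
  have [s [B's Bs]] := filter_ex (filterI VB' (EV _ EB)).
  have [t fts At] := BA s Bs; exists t; split; last exact: AA'.
  by rewrite /preimage /= fts.
have [|z Uz] := ucp_pt uZ (U := U).
  by split=> // A DA; apply: DU; exists A.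
exists z => //; apply: (ucp_rel_inj uW _ Vw).
by rewrite -fU; exact: Fr.
Qed.

End ultracoproduct_map.

(** * Ultracoproducts of ultracoproducts *)

Section iterated_ultracoproduct.
Context (R : realType) (I : Type) (D : set_system I).
Context (J : I -> Type) (E : forall i, set_system (J i)).
Context (Y : forall i, J i -> topologicalType).
Context (Q : I -> topologicalType).
Context (relQ : forall i, set_system {j & @Y i j} -> Q i -> Prop).
Context (Z : topologicalType) (rel : set_system {i & Q i} -> Z -> Prop).
Hypotheses (UD : UltraFilter D) (UE : forall i, UltraFilter (@E i)).
Hypothesis uQ : forall i, ultracoproduct R (@E i) (@relQ i).
Hypothesis uZ : ultracoproduct R D rel.

Definition sum_filter : set_system {i & J i} :=
  [set A | D [set i | @E i [set j | A (existT _ i j)]]].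

Lemma sum_filter_ultra : UltraFilter sum_filter.
Proof.
apply: (@bind_ultraP _ _ D (fun i => existT J i @ @E i)) => // i.
exact: ultra_fmap.
Qed.

Let Y' (k : {i & J i}) : topologicalType := @Y _ (projT2 k).

Let inner (i : I) (t : {j & @Y i j}) : {k & Y' k} :=
  existT Y' (existT J i (projT1 t)) (projT2 t).

Context (W : topologicalType) (relW : set_system {k & Y' k} -> W -> Prop).
Hypothesis uW : ultracoproduct R sum_filter relW.

(** [Z] is compared with a given ultracoproduct [W] along [sum_filter]. The second clause says that
    limits may be computed in two stages, first in the fibres [Q i], then in [Z]. *)
Lemma ultracoproduct_iterated : exists rel' : set_system {k & Y' k} -> Z -> Prop,
  ultracoproduct R sum_filter rel' /\
  forall (K : topologicalType) (c : {k & Y' k} -> K) (C_ : {i & Q i} -> K)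
      (C : Z -> K), compactum K -> fibrewise_continuous c ->
    (forall i, represents (@relQ i) (c \o @inner i) (fun q => C_ (existT _ i q))) ->
    represents rel C_ C -> represents rel' c C.
Proof.
(* A point of [Z] is the limit of some [V] on the disjoint union of the [Q i];
   replacing each point of [Q i] by an ultrafilter converging to it turns [V]
   into an ultrafilter over [sum_filter], whose limit defines [Psi : Z -> W]. *)
have /choice_dep[u uP] : forall t : {i & Q i}, exists U, @relQ _ U (projT2 t).
  by move=> t; exact: ucp_ex (uQ _) _.
pose inn (t : {i & Q i}) := @inner (projT1 t) @ u t.
have Uinn t : UltraFilter (inn t).
  by apply: ultra_fmap; have [] := ucp_over (uQ _) (uP t).
have bind_over V z : rel V z -> lies_over sum_filter (bind_ultra V inn).
  move=> Vz; have [UV DV] := ucp_over uZ Vz.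
  split; first exact: bind_ultraP.
  move=> A /DV; apply: filterS => t /= EA.
  exact: (ucp_over (uQ _) (uP t)).2 EA.
have /choice[Psi PsiE] : forall z, exists w, exists2 V, rel V z &
    relW (bind_ultra V inn) w.
  move=> z; have [V Vz] := ucp_ex uZ z.
  by have [w Vw] := ucp_pt uW (bind_over _ _ Vz); exists w, V.
have bind_cvg (K : topologicalType) (c : {k & Y' k} -> K) (C_ : {i & Q i} -> K)
    V (k : K) :
    (forall i, represents (@relQ i) (c \o @inner i)
       (fun q => C_ (existT _ i q))) ->
    UltraFilter V -> C_ @ V --> k -> c @ bind_ultra V inn --> k.
  move=> cC_ UV Vk A; rewrite nbhsE => -[O [oO Ok] OA].
  have VO : V [set t | O (C_ t)] by apply: Vk; exact: open_nbhs_nbhs.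
  apply: (@filterS _ V _ _ _ _ VO) => -[i q] /= Oq.
  have /= := cC_ i _ _ (uP (existT _ i q)).
  have Uu := (ucp_over (uQ i) (uP (existT _ i q))).1.
  move=> /(_ O); rewrite /nbhs /= => /(_ (open_nbhs_nbhs (conj oO Oq))).
  by apply: (@filterS _ (u (existT Q i q))) => t /OA.
have PsiC (K : topologicalType) (c : {k & Y' k} -> K) (C_ : {i & Q i} -> K)
    (C : Z -> K) (CW : W -> K) : compactum K ->
    (forall i, represents (@relQ i) (c \o @inner i)
       (fun q => C_ (existT _ i q))) ->
    represents rel C_ C -> represents relW c CW -> CW \o Psi = C.
  move=> cK cC_ C_C cCW; apply/funext => z; have [V Vz Vw] := PsiE z.
  have [UV _] := ucp_over uZ Vz; have [UB _] := ucp_over uW Vw.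
  apply: (cvg_unique cK.2 (cCW _ _ Vw)); apply: bind_cvg (C_C _ _ Vz) => //.
have reps (K : topologicalType) (c : {k & Y' k} -> K) : compactum K ->
    fibrewise_continuous c -> exists2 C_ : {i & Q i} -> K,
      fibrewise_continuous C_ & forall i, represents (@relQ i) (c \o @inner i)
        (fun q => C_ (existT _ i q)).
  move=> cK cc.
  have /choice_dep[C CP] : forall i, exists C : Q i -> K, continuous C /\
      represents (@relQ i) (c \o @inner i) C.
    move=> i; have [j y|C ? ?] := ucp_lim (uQ i) (c := c \o @inner i) cK.
      exact: (cc (existT J i j)).
    by exists C.
  by exists (fun t => C (projT1 t) (projT2 t)) => i; have [] := CP i.
have lim (K : topologicalType) (c : {k & Y' k} -> K) : compactum K ->
    fibrewise_continuous c -> exists C_ C CW, [/\ continuous C,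
      forall i, represents (@relQ i) (c \o @inner i)
        (fun q => C_ (existT _ i q)), represents rel C_ C,
      represents relW c CW & CW \o Psi = C].
  move=> cK cc; have [C_ cC_ C_c] := reps _ _ cK cc.
  have [C cC CC_] := ucp_lim uZ cK cC_; have [CW _ CWc] := ucp_lim uW cK cc.
  by exists C_, C, CW; split=> //; exact: PsiC CWc.
have cPsi : continuous Psi.
  apply: (compactum_continuous (R := R) (ucp_compactum uW)) => CW0 cCW0.
  have [c cc cCW0'] := ucp_lift uW cCW0.
  have [C_ [C [CW [cC _ _ CWc CWC]]]] := lim _ _ (unit_itv_compactum R) cc.
  by rewrite (represents_inj uW (unit_itv_compactum R).2 cCW0' CWc) CWC.
(* A function separating a missed point from [range Psi] takes values in an
   open set [O] on [range Psi], hence on almost all fibres of [W]. *)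
have sPsi w : exists z, Psi z = w.
  apply: contrapT => /forallNP nw.
  have [|phi [O [P [cphi oO oP OP [Pw OPsi]]]]] := compactum_separated R
      (ucp_compactum uW) (compactum_range_closed (ucp_compactum uZ)
        (ucp_compactum uW) cPsi) (k := w).
    by move=> [z _ /nw].
  have [c cc cphi'] := ucp_lift uW cphi.
  have [C_ [C [CW [cC C_c CC_ CWc CWC]]]] := lim _ _ (unit_itv_compactum R) cc.
  have phiW := represents_inj uW (unit_itv_compactum R).2 cphi' CWc.
  have DO : D [set i | forall q, O (C_ (existT _ i q))].
    apply: (represents_open uZ UD CC_ oO) => z.
    by rewrite -CWC -phiW; apply: OPsi; exists z.
  have SO : sum_filter [set k | forall y, O (c (existT Y' k y))].
    apply: filterS DO => i /= Oi.
    have := represents_open (uQ i) (UE i) (C_c i) oO Oi.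
    exact: (@filterS _ (@E i)).
  have [V Vw] := ucp_ex uW w; have [UV SV] := ucp_over uW Vw.
  have VP : V [set t | P (c t)].
    by apply: (cphi' _ _ Vw); apply: open_nbhs_nbhs; split.
  have [[k y] [/= Pc Oc]] := filter_ex (filterI VP (SV _ SO)).
  suff : (O `&` P) (c (existT _ k y)) by rewrite OP.
  by split=> //; exact: Oc.
exists (fun U z => relW U (Psi z)); split; last first.
  move=> K c C_ C cK cc cC_ C_C U z /= Uz.
  have [CW _ CWc] := ucp_lim uW cK cc.
  by rewrite -(PsiC _ _ _ _ _ cK cC_ C_C CWc); exact: CWc.
split.
- exact: ucp_compactum uZ.
- by move=> U z /(ucp_over uW).
- by move=> z; have [U] := ucp_ex uW (Psi z); exists U.
- by move=> U /(ucp_pt uW)[w Uw]; have [z Pz] := sPsi w; exists z; rewrite Pz.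
- move=> K c cK cc; have [C_ [C [CW [cC _ _ CWc CWC]]]] := lim _ _ cK cc.
  by exists C => // U z /= Uz; rewrite -CWC; exact: CWc.
- move=> C cC; have [C_ cC_ C_C] := ucp_lift uZ cC.
  have /choice_dep[c cP] : forall i, exists c : {j & @Y i j} -> unit_itv R,
      fibrewise_continuous c /\ represents (@relQ i) c
        (fun q => C_ (existT _ i q)).
    by move=> i; have [c ? ?] := ucp_lift (uQ i) (cC_ i); exists c.
  pose c' (t : {k & Y' k}) := c (projT1 (projT1 t))
    (existT _ (projT2 (projT1 t)) (projT2 t)).
  have cc' : fibrewise_continuous c'.
    by move=> [i j] y; exact: ((cP i).1 j).
  exists c' => // U z /= Uz; have [CW _ CWc] := ucp_lim uW
    (unit_itv_compactum R) cc'.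
  have rc i : represents (@relQ i) (c' \o @inner i)
      (fun q => C_ (existT _ i q)).
    move=> V q Vq; rewrite (_ : c' \o _ = c i); first exact: (cP i).2 Vq.
    by apply/funext => -[].
  by rewrite -(PsiC _ _ _ _ _ (unit_itv_compactum R) rc C_C CWc); exact: CWc.
Qed.

End iterated_ultracoproduct.

(** * Existence of ultracoproducts *)

Section beta_fibre.
Context (R : realType) (I : Type) (D : set_system I).
Context (X : I -> topologicalType) (T : topologicalType).
Variables (tau : {i & X i} -> T) (tau' : T -> {i & X i}).
Hypothesis UD : UltraFilter D.
Hypothesis tauK : cancel tau tau'.
Hypothesis tau_cont : fibrewise_continuous tau.
Hypothesis tau_univ : forall (K : topologicalType) (c : T -> K),
  fibrewise_continuous (c \o tau) -> continuous c.

(** The space [T] plays the disjoint union of the [X i], with [tau] as identification. Keeping it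
    abstract covers both the sigma type and the product [X * I] of the literal ultracopower. *)
Definition beta_rel (U : set_system {i & X i}) (p : beta R T) : Prop :=
  lies_over D U /\ (@beta_unit R T \o tau) @ U --> p.

Lemma beta_rel_ext (K : topologicalType) (c : T -> K) U p : compactum K ->
  continuous c -> beta_rel U p -> c \o tau @ U --> beta_ext c p.
Proof.
move=> cK cc [[UU _] Up]; have [cext extE] := beta_ext_spec R cK cc.
rewrite -[in X in X --> _]extE.
exact: (@cvg_continuous_comp _ _ _ U _ (@beta_unit R T \o tau) p).
Qed.

Lemma beta_unit_dense (p : beta R T) (N : set (beta R T)) :
  nbhs p N -> exists t, N (beta_unit R t).
Proof.
move=> [_ [[V oV <-] Vp VN]].
have /set_mem/(_ V) := valP p.
case; first by apply: open_nbhs_nbhs; split.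
by move=> _ [[t _ <-] Vt]; exists t; exact: VN.
Qed.

Variable P : set (beta R T).
Hypothesis PE : forall p, P p <-> exists U, beta_rel U p.

(** Near a point [p] of the closure there are limits of ultrafilters over [D]. So preimages of
    neighbourhoods of [p] meet preimages of sets of [D], and a common ultrafilter converges to
    [p]. *)
Lemma beta_fibre_closed : closed P.
Proof.
move=> p clp; apply/PE.
have FF : Filter (filter_from D (preimage (@projT1 I X))).
  exact: preimage_filter.
pose bt := @beta_unit R T \o tau.
have FG := preimage_filter bt (nbhs_filter p).
have [|U [UU DU pU]] := ultra_meet FF FG.
  move=> A' N' [A DA AA']; rewrite /filter_from /= => -[N].
  rewrite nbhsE => -[O [oO Op] ON] NN'.
  have [|q [Pq Oq]] := clp O; first exact: open_nbhs_nbhs.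
  have /PE[V [[UV DV] Vq]] := Pq.
  have VO : V (bt @^-1` O) by apply: Vq; exact: open_nbhs_nbhs.
  have [t [At Ot]] := filter_ex (filterI (DV _ DA) VO).
  by exists t; split; [exact: AA'|apply/NN'/ON].
exists U; split; first by split=> // A DA; apply: DU; exists A.
by move=> N pN; apply: pU; exists N.
Qed.

(* Tietze; the absolute value keeps the extension in [0,1]. *)
Lemma beta_fibre_extend (C : set_type P -> unit_itv R) : continuous C ->
  exists2 G : beta R T -> unit_itv R, continuous G & forall z, G (set_val z) = C z.
Proof.
move=> cC.
(* The value 0 off [P] is a default; continuity is asserted only within [P]. *)
pose f (p : beta R T) : R := if pselect (P p) is left Pp
  then set_val (C (SigSub (mem_set Pp))) else 0.
have fE p (Pp : P p) : f p = set_val (C (SigSub (mem_set Pp))).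
  by rewrite /f; case: pselect => // Pp'; congr (set_val (C _)); exact: val_inj.
have f01 p : P p -> `|f p| <= 1 /\ 0 <= f p.
  move=> Pp; have := set_valP (C (SigSub (mem_set Pp))).
  by rewrite fE /= in_itv /= => /andP[? ?]; split=> //; rewrite ger0_norm.
have nT := compact_normal (beta_compactum R T).2 (beta_compactum R T).1.
have cf : {within P, continuous f}.
  apply/subspace_continuousP => p Pp N.
  move=> fN; have {fN} : nbhs (set_val (C (SigSub (mem_set Pp)))) N.
    by rewrite -fE; exact: fN.
  move=> /(@set_val_continuous _ _ (C _)) /cC.
  move=> [_ [[V oV <-] Vz VN]].
  rewrite /= /nbhs /= /within /=; apply: (@filterS _ (nbhs p) _ V).
    by move=> q Vq Pq; have := VN (SigSub (mem_set Pq)) Vq; rewrite /= -fE.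
  by apply: open_nbhs_nbhs; split.
have [|g [fg cg g1]] := continuous_bounded_extension nT beta_fibre_closed
    (@ltr01 R) cf.
  by move=> p /f01[].
have g01 p : `|g p| \in [set` `[0%R : R, 1%R]].
  by apply/mem_set; rewrite /= in_itv /= normr_ge0 g1.
exists (fun p => SigSub (g01 p)).
  move=> p U [_ [[V oV <-] Vp VU]].
  have cn : continuous (fun p => `|g p|).
    by move=> q; apply: continuous_comp; [exact: cg|exact: norm_continuous].
  apply: (@filterS _ (nbhs p) _ _ _ _ (cn p V _)).
    by move=> s Vs; exact: VU.
  by apply: open_nbhs_nbhs; split.
move=> z; apply: val_inj; have Pz := set_valP z.
have -> : z = SigSub (mem_set Pz) by exact: val_inj.
apply: etrans (fE _ Pz); have [_ f0] := f01 _ Pz.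
by rewrite -[RHS](ger0_norm f0) fg//; exact/mem_set.
Qed.

(** Families of maps pass to the limit by Stone-Cech extension; conversely, a map on [P] extends to
    [beta R T] and is then restricted to [T]. *)
Lemma beta_fibre_ultracoproduct :
  ultracoproduct R D (fun U (z : set_type P) => beta_rel U (set_val z)).
Proof.
have cK : compactum (beta R T) := beta_compactum R T.
split.
- split; last exact: set_type_hausdorff cK.2.
  apply: set_type_compact; apply: subclosed_compact cK.1 _ => //.
  exact: beta_fibre_closed.
- by move=> U z [].
- by move=> z; apply/PE; exact: set_valP.
- move=> U oU; have UU := oU.1.
  have [p Up] := compactum_ultra_cvg cK (ultra_fmap (@beta_unit R T \o tau) UU).
  have Pp : P p by apply/PE; exists U.
  by exists (SigSub (mem_set Pp)).
- move=> K c cK' cc.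
  have ctK : (c \o tau') \o tau = c by apply/funext => t; rewrite /= tauK.
  have cc' : continuous (c \o tau') by apply: tau_univ; rewrite ctK.
  exists (beta_ext (c \o tau') \o set_val).
    move=> z; apply: continuous_comp; first exact: set_val_continuous.
    exact: (beta_ext_spec R cK' cc').1.
  by move=> U z /(beta_rel_ext cK' cc'); rewrite ctK.
- move=> C cC; have [G cG GE] := beta_fibre_extend cC.
  exists (G \o @beta_unit R T \o tau).
    move=> i x; apply: (@continuous_comp _ _ _ (fun x => tau (existT X i x))
      (G \o @beta_unit R T)); first exact: tau_cont.
    by apply: continuous_comp; [exact: beta_unit_continuous|exact: cG].
  move=> U z [[UU _] Uz]; rewrite -GE.
  exact: (@cvg_continuous_comp _ _ _ U _ (@beta_unit R T \o tau)).
Qed.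

End beta_fibre.

Lemma ultracoproduct_exists (R : realType) (I : Type) (D : set_system I)
    (X : I -> topologicalType) : UltraFilter D ->
  exists (Z : topologicalType) (rel : set_system {i & X i} -> Z -> Prop),
    ultracoproduct R D rel.
Proof.
move=> UD; pose T : topologicalType := {i : {classic I} & X i}.
pose P : set (beta R T) :=
  [set p | exists U, @beta_rel R I D X T id U p].
exists (set_type P), (fun U z => @beta_rel R I D X T id U (set_val z)).
apply: (@beta_fibre_ultracoproduct R I D X T id id) => //.
- by move=> i; exact: (@existT_continuous {classic I} X i).
- by move=> K c cc [i x] N /cc.
Qed.

(** * The ultracopower inside the Stone-Cech compactification *)

Section literal_ultracopower.
Context (R : realType) (X : topologicalType) (I : discreteTopologicalType).
Context (D : set_system I).
Hypothesis UD : UltraFilter D.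

Definition swap_total (t : {i : I & X}) : (X * I)%type := (projT2 t, projT1 t).

Definition ultracopower_rel (U : set_system {i : I & X})
    (z : set_type (@ultracopower R X I D)) : Prop :=
  beta_rel D swap_total U (set_val z).

Lemma discrete_to_continuous (K : topologicalType) (f : I -> K) : continuous f.
Proof.
move=> i N fN; apply: (@filterS _ (nbhs i) _ [set i]).
  by move=> _ ->; exact: (nbhs_singleton fN).
exact: discrete_set1.
Qed.

Lemma ultracopowerP (p : beta R (X * I)%type) :
  @ultracopower R X I D p <-> exists U, beta_rel D swap_total U p.
Proof.
have csnd : continuous (fun xi : X * I => beta_unit R xi.2).
  move=> xi; apply: (@continuous_comp _ _ _ snd (@beta_unit R I)).
    exact: cvg_snd.
  exact: beta_unit_continuous.
have [cext extE] := beta_ext_spec R (beta_compactum R I) csnd.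
have swapK : cancel (fun xi : X * I => existT (fun=> X) xi.2 xi.1) swap_total.
  by case.
have ext_lim U : UltraFilter U ->
    (@beta_unit R (X * I)%type \o swap_total) @ U --> p ->
    (@beta_unit R I \o @projT1 _ _) @ U -->
      beta_ext (fun xi : X * I => beta_unit R xi.2) p.
  move=> UU Up; have := cvg_continuous_comp _ cext Up; rewrite compA extE.
  by apply.
split=> [Dp|[U [[UU DU] Up]]]; last first.
  have eD : @projT1 I (fun=> X) @ U = D.
    by apply: ultra_sub_eq => // ; exact: ultra_fmap.
  by rewrite /ultracopower /= -eD; exact: ext_lim.
have [|U [UU _ pU]] := ultra_meet (globally_filter setT)
    (preimage_filter (@beta_unit R (X * I)%type \o swap_total) (nbhs_filter p)).
  move=> A B TA [N pN NB]; have [t Nt] := beta_unit_dense pN.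
  by exists (existT _ t.2 t.1); split; [exact: TA|apply: NB; rewrite /= swapK].
have Up : (@beta_unit R (X * I)%type \o swap_total) @ U --> p.
  by move=> N pN; apply: pU; exists N.
exists U; split=> //; split=> // A DA.
have [//|UnA] := in_ultra_setVsetC [set t | A (projT1 t)] UU.
have cb : compactum bool by split; [exact: bool_compact|exact: discrete_hausdorff].
(* The indicator of [A], extended to [beta R I], has a single value at [q], the common limit of [D]
   and of the image of [U]. Hence [A] in [D] excludes the complement of [A] from that image. *)
pose ind (i : I) := `[< A i >].
have [cind indE] := beta_ext_spec R cb (@discrete_to_continuous bool ind).
have := ext_lim U UU Up; move: Dp; rewrite /ultracopower /=.
set q := beta_ext _ p => Dq Uq; have indD : ind @ D --> beta_ext ind q.
  by have := cvg_continuous_comp _ cind Dq; rewrite indE; apply.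
have indU : (ind \o @projT1 _ _) @ U --> beta_ext ind q.
  by have := cvg_continuous_comp _ cind Uq; rewrite compA indE; apply.
have {}indD : D [set i | ind i = beta_ext ind q].
  exact: (indD _ (discrete_set1 (beta_ext ind q))).
have {}indU : U [set t | ind (projT1 t) = beta_ext ind q].
  exact: (indU _ (discrete_set1 (beta_ext ind q))).
have [i [Ai]] := filter_ex (filterI DA indD).
have [t [/= nAt]] := filter_ex (filterI UnA indU).
by move=> /= <-; rewrite /ind asboolT// asboolF.
Qed.

Lemma ultracopower_ultracoproduct : ultracoproduct R D ultracopower_rel.
Proof.
apply: (@beta_fibre_ultracoproduct _ _ _ _ _ swap_total
   (fun xi => existT _ xi.2 xi.1) UD).
- by case.
- move=> i x; apply: cvg_pair; [exact: cvg_id|exact: cvg_cst].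
- move=> K c cc [x i] N cN.
  exists ([set y | N (c (y, i))], [set i]).
    by split; [exact: (cc i x)|exact: discrete_set1].
  by move=> [y _] [/= Ny ->].
- exact: ultracopowerP.
Qed.

Lemma codiagonal_rel U z : compactum X -> ultracopower_rel U z ->
  @projT2 I (fun=> X) @ U --> @codiagonal R X I D z.
Proof.
move=> cX Uz; have cfst : continuous (fun xi : X * I => xi.1).
  by move=> xi; exact: cvg_fst.
exact: (beta_rel_ext cX cfst Uz).
Qed.

End literal_ultracopower.

(** * Levels *)

Lemma well_order_ind (d : Order.disp_t) (W : orderType d)
    (hW : wochoice.well_order (fun a b : W => (a <= b)%O)) (P : W -> Prop) :
  (forall b, (forall a, (a < b)%O -> P a) -> P b) -> forall b, P b.
Proof.
move=> Pind b; apply: contrapT => nPb.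
have [|m [[/asboolP nPm mP] _]] := hW [pred x | `[< ~ P x >]].
  by exists b; apply/asboolP.
apply: nPm; apply: Pind => a am; apply: contrapT => nPa.
have /mP : a \in [pred x | `[< ~ P x >]] by apply/asboolP.
by rewrite leNgt am.
Qed.

Definition total_value (I Y : Type) (t : {i : I & Y}) : Y := projT2 t.

Lemma total_value_continuous (I : Type) (Y : topologicalType) :
  fibrewise_continuous (@total_value I Y).
Proof. by move=> i x; exact: cvg_id. Qed.

(* [represents rel total_value p] says that [p] is the codiagonal of the
   ultracopower [Q].  Since the condition is imposed for all [a < b], zero,
   successor and limit ordinals need not be distinguished. *)
Inductive ultralevel (R : realType) (d : Order.disp_t) (W : orderType d) (b : W)
    (X Y : topologicalType) (f : X -> Y) : Prop :=
  Ultralevel of compactum X & compactum Y & continuous f & range f = [set: Y]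
  & (forall a : W, (a < b)%O ->
      exists (I : Type) (D : set_system I) (Q : topologicalType)
        (rel : set_system {i : I & Y} -> Q -> Prop) (h : Q -> X),
      [/\ UltraFilter D, ultracoproduct R D rel, ultralevel R a h &
          represents rel (@total_value I Y) (f \o h)]).

(** Fibres are matched by homeomorphisms because evaluation of sections compares [X i] with [Y j]
    along a propositional equality [phi i = j]. *)
Definition reindexing (I J : Type) (X : I -> topologicalType)
    (Y : J -> topologicalType) (phi : I -> J) (f : {i & X i} -> {j & Y j}) :=
  (forall j, exists i, phi i = j) /\
  forall i, exists (e : X i -> Y (phi i)) (g : Y (phi i) -> X i),
    [/\ continuous e, continuous g, cancel e g, cancel g e &
        forall x, f (existT X i x) = existT Y (phi i) (e x)].

Lemma ultracoproduct_sections (I J : Type) (D : set_system I)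
    (E : set_system J) (phi : I -> J) :
  UltraFilter D -> UltraFilter E -> (forall j, exists i, phi i = j) ->
  (forall B, E B -> D (phi @^-1` B)) ->
  exists2 H : set_system (forall j, {i | phi i = j}), UltraFilter H &
    forall A, D A -> H [set s | E [set j | A (sval (s j))]].
Proof.
move=> UD UE sphi DE.
pose Sec := forall j, {i | phi i = j}.
have PF : ProperFilter (filter_from D
    (fun A => [set s : Sec | E [set j | A (sval (s j))]])).
  apply: filter_from_proper; last first.
    move=> A DA.
    have EA : E (phi @` A).
      have [//|/DE DnA] := in_ultra_setVsetC (phi @` A) UE.
      have [i [Ai]] := filter_ex (filterI DA DnA).
      by case; exists i.
    have /choice_dep[s sA] : forall j, exists s : {i | phi i = j},
        (phi @` A) j -> A (sval s).
      move=> j; have [[i Ai ij]|nAj] := pselect ((phi @` A) j).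
        by exists (exist _ i ij).
      by have [i ij] := sphi j; exists (exist _ i ij) => /nAj.
    by exists s; apply: filterS EA.
  apply: filter_from_filter; first by exists setT; exact: filterT.
  move=> A B DA DB; exists (A `&` B); first exact: filterI.
  by move=> s /= EAB; split; apply: filterS EAB => j [].
have [H [UH DH]] := ultraFilterLemma PF.
by exists H => // A DA; apply: DH; exists A.
Qed.

Section levels.
Context (R : realType) (d : Order.disp_t) (W : orderType d).
Hypothesis hW : wochoice.well_order (fun a b : W => (a <= b)%O).

Lemma ultralevel_le (a b : W) (X Y : topologicalType) (f : X -> Y) :
  (a <= b)%O -> ultralevel R b f -> ultralevel R a f.
Proof.
move=> ab [cX cY cf sf fb]; split=> // a' a'a; apply: fb.
exact: lt_le_trans ab.
Qed.

(* [Q], the ultracopower of [Z'] along an ultrafilter [H] on sections of [phi],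
   maps to [Z] by evaluation of sections; this map is again induced by a
   reindexing, so that the induction hypothesis applies to it. *)
Lemma reindexing_level (b : W) :
  forall (I J : Type) (D : set_system I) (E : set_system J)
    (X : I -> topologicalType) (Y : J -> topologicalType)
    (Z Z' : topologicalType) (rel : set_system {i & X i} -> Z -> Prop)
    (rel' : set_system {j & Y j} -> Z' -> Prop)
    (phi : I -> J) (f : {i & X i} -> {j & Y j}) (F : Z -> Z'),
  UltraFilter D -> UltraFilter E ->
  ultracoproduct R D rel -> ultracoproduct R E rel' ->
  reindexing phi f -> (forall B, E B -> D (phi @^-1` B)) ->
  continuous F -> (forall U z, rel U z -> rel' (f @ U) (F z)) ->
  ultralevel R b F.
Proof.
elim/(well_order_ind hW): b => b IHb I J D E X Y Z Z' rel rel' phi f F.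
move=> UD UE uZ uZ' [sphi fP] DE cF Frel.
split=> //; [exact: ucp_compactum uZ|exact: ucp_compactum uZ'| |].
  apply: (ultracoproduct_map_surj uZ uZ' _ Frel) => A DA.
  exists (phi @` A).
    have [//|/DE DnA] := in_ultra_setVsetC (phi @` A) UE.
    have [i [Ai]] := filter_ex (filterI DA DnA).
    by case; exists i.
  move=> [j y] /= [i Ai ij]; have [e [g [_ _ _ gK fE]]] := fP i.
  case: _ / ij y => y.
  by exists (existT _ i (g y)) => //; rewrite fE gK.
move=> a ab.
pose Sec := forall j, {i | phi i = j}.
have [H UH DH] := ultracoproduct_sections UD UE sphi DE.
have /choice_dep[eg egP] : forall js : {j & {i | phi i = j}},
    exists eg : (X (sval (projT2 js)) -> Y (projT1 js)) *
                (Y (projT1 js) -> X (sval (projT2 js))),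
      [/\ continuous eg.1, continuous eg.2, cancel eg.1 eg.2,
        cancel eg.2 eg.1 &
        forall x, f (existT X _ x) = existT Y _ (eg.1 x)].
  move=> [j [i ij]] /=; case: _ / ij.
  by have [e [g egP]] := fP i; exists (e, g).
have [Q [relQ uQ]] := @ultracoproduct_exists R Sec H (fun=> Z') UH.
pose Y' (k : {_ : Sec & J}) := Y (projT2 k).
have [V [relV uV]] := @ultracoproduct_exists R _ _ Y'
  (@sum_filter_ultra _ H (fun=> J) (fun=> E) UH (fun=> UE)).
have [relQ' [uQ' relQ'P]] := @ultracoproduct_iterated R Sec H (fun=> J)
  (fun=> E) (fun=> Y) (fun=> Z') (fun=> rel') Q relQ UH (fun=> UE)
  (fun=> uZ') uQ V relV uV.
pose js (k : {_ : Sec & J}) : {j & {i | phi i = j}} :=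
  existT _ (projT2 k) (projT1 k (projT2 k)).
pose psi (k : {_ : Sec & J}) : I := sval (projT1 k (projT2 k)).
pose q (t : {k & Y' k}) : {i & X i} :=
  existT X (psi (projT1 t)) ((eg (js (projT1 t))).2 (projT2 t)).
have [||h ch hrel] := ultracoproduct_map uQ' uZ (f := q).
- move=> K c cc k y; have [_ cg _ _ _] := egP (js k).
  apply: (@continuous_comp _ _ _ (eg (js k)).2 (fun x => c (existT X (psi k) x))).
    exact: cg.
  exact: cc.
- by move=> A /DH; apply: (@filterS _ H) => s /=; apply: (@filterS _ E) => j Aj y.
exists Sec, H, Q, relQ, h; split=> //.
  apply: (IHb a ab _ _ _ _ _ _ _ _ _ _ psi q h _ UD uQ' uZ) => //.
    exact: (@sum_filter_ultra _ H (fun=> J) (fun=> E) UH (fun=> UE)).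
  split.
    move=> i.
    (* For surjectivity of [psi], a section is chosen that passes through [i] and is evaluated at
       [phi i]. *)
    have /choice_dep[s sE] : forall j, exists s : {i | phi i = j},
        phi i = j -> sval s = i.
      move=> j; have [ij|nij] := pselect (phi i = j).
        by exists (exist _ i ij).
      by have [i' i'j] := sphi j; exists (exist _ i' i'j) => /nij.
    by exists (existT _ s (phi i)); exact: sE.
  move=> k; have [ce cg eK gK _] := egP (js k).
  by exists (eg (js k)).2, (eg (js k)).1.
have [p cp pP] := ucp_lim uQ (ucp_compactum uZ')
  (@total_value_continuous Sec Z').
(* Since [f \o q] leaves the value in [Y] unchanged, both maps, composed with any [C] to the
   interval, are represented by the same family. *)
suff -> : F \o h = p by [].
apply/funext => z.
apply: (compactum_ext (R := R) (ucp_compactum uZ')) => C cC.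
have [c cc cC'] := ucp_lift uZ' cC.
have relp : represents relQ' (fun t => c (existT Y (projT2 (projT1 t)) (projT2 t)))
    (C \o p).
  apply: (relQ'P _ _ (C \o @total_value Sec Z')) => //.
  - exact: unit_itv_compactum.
  - move=> s; rewrite (_ : _ \o _ = c) //.
    by apply/funext => -[].
  - exact: (represents_comp uQ).
have relh : represents relQ' (fun t => c (existT Y (projT2 (projT1 t)) (projT2 t)))
    (C \o (F \o h)).
  move=> U w /hrel/Frel/cC'; rewrite (_ : (fun t => _) = c \o f \o q) //.
  apply/funext => -[k y] /=; rewrite /q /=.
  have [_ _ _ gK fE] := egP (js k).
  by rewrite fE gK.
exact: (congr1 (@^~ z) (represents_inj uQ' (unit_itv_compactum R).2 relh relp)).
Qed.

End levels.

(** * Levels of ultracoproducts and of composites *)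

(** Bundles the data in one clause of [ultralevel], so that they can be chosen simultaneously for a
    family of maps. *)
Record factorization (X Y : topologicalType) := Factorization {
  fact_index : Type;
  fact_filter : set_system fact_index;
  fact_space : topologicalType;
  fact_rel : set_system {i : fact_index & Y} -> fact_space -> Prop;
  fact_map : fact_space -> X }.

Arguments fact_filter {X Y} f.
Arguments fact_rel {X Y} f.
Arguments fact_map {X Y} f.

Section levels.
Context (R : realType) (d : Order.disp_t) (W : orderType d).
Hypothesis hW : wochoice.well_order (fun a b : W => (a <= b)%O).

Definition factorization_of (a : W) (X Y : topologicalType) (f : X -> Y)
    (t : factorization X Y) :=
  [/\ UltraFilter (fact_filter t),
      ultracoproduct R (fact_filter t) (fact_rel t),
      ultralevel R a (fact_map t) &
      represents (fact_rel t) (@total_value _ Y) (f \o fact_map t)].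

Lemma ultralevel_factorization (a b : W) (X Y : topologicalType) (f : X -> Y) :
  (a < b)%O -> ultralevel R b f -> exists t, factorization_of a f t.
Proof.
move=> ab [_ _ _ _ /(_ a ab)[I [D [Q [rel [h hP]]]]]].
by exists (@Factorization X Y I D Q rel h).
Qed.

Definition fibre_map (I : Type) (X Y : I -> topologicalType)
    (f : forall i, X i -> Y i) (t : {i & X i}) : {i & Y i} :=
  existT Y (projT1 t) (f _ (projT2 t)).

Lemma fibre_map_continuous (I : Type) (X Y : I -> topologicalType)
    (f : forall i, X i -> Y i) (K : topologicalType) (c : {i & Y i} -> K) :
  (forall i, continuous (f i)) -> fibrewise_continuous c ->
  fibrewise_continuous (c \o fibre_map f).
Proof.
move=> cf cc i x.
apply: (@continuous_comp _ _ _ (f i) (fun y => c (existT _ i y))).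
  exact: cf.
exact: cc.
Qed.

Definition lifts_along (I : Type) (X Y : I -> topologicalType)
    (f : forall i, X i -> Y i) (Z Z' : topologicalType)
    (rel : set_system {i & X i} -> Z -> Prop)
    (rel' : set_system {i & Y i} -> Z' -> Prop) (F : Z -> Z') :=
  continuous F /\ forall U z, rel U z -> rel' (fibre_map f @ U) (F z).

Lemma fibre_map_ultracoproduct (I : Type) (D : set_system I)
    (X Y : I -> topologicalType) (f : forall i, X i -> Y i)
    (Z Z' : topologicalType)
    (rel : set_system {i & X i} -> Z -> Prop)
    (rel' : set_system {i & Y i} -> Z' -> Prop) :
  UltraFilter D -> ultracoproduct R D rel -> ultracoproduct R D rel' ->
  (forall i, continuous (f i)) -> exists F, lifts_along f rel rel' F.
Proof.
move=> UD uZ uZ' cf.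
have [||F cF Frel] := ultracoproduct_map uZ uZ' (f := fibre_map f).
- by move=> K c; exact: fibre_map_continuous.
- by move=> A; apply: (@filterS _ D) => i Ai x.
by exists F.
Qed.

Definition level_ultracoproduct_at (b : W) :=
  forall (I : Type) (D : set_system I) (X Y : I -> topologicalType)
    (f : forall i, X i -> Y i) (Z Z' : topologicalType)
    (rel : set_system {i & X i} -> Z -> Prop)
    (rel' : set_system {i & Y i} -> Z' -> Prop) (F : Z -> Z'),
  UltraFilter D -> ultracoproduct R D rel -> ultracoproduct R D rel' ->
  lifts_along f rel rel' F -> (forall i, ultralevel R b (f i)) ->
  ultralevel R b F.

Definition level_comp_at (b : W) :=
  forall (X Y Z : topologicalType) (f : X -> Y) (g : Y -> Z),
  ultralevel R b f -> ultralevel R b g -> ultralevel R b (g \o f).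

(** Let [f \o h] and [g \o k] be codiagonals, and let [kE] be the ultracopower of [k] along the
    ultrafilter belonging to [h]. By naturality [g \o f \o h \o kE] is the codiagonal of an iterated
    ultracopower of [Z]. *)
Lemma level_comp_step (b : W) :
  (forall a, (a < b)%O -> level_ultracoproduct_at a) ->
  (forall a, (a < b)%O -> level_comp_at a) ->
  level_comp_at b.
Proof.
move=> IHu IHc X Y Z f g lf lg.
have [cX cY cf sf _] := lf; have [_ cZ cg sg _] := lg.
split=> //.
- by move=> x; apply: continuous_comp; [exact: cf|exact: cg].
- apply/seteqP; split=> // z _.
  have [y _ <-] : range g z by rewrite sg.
  have [x _ <-] : range f y by rewrite sf.
  by exists x.
move=> a ab.
have [_ _ _ _ /(_ a ab)[J [E [Q [relQ [h [UE uQ lh hP]]]]]]] := lf.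
have [_ _ _ _ /(_ a ab)[K [G [S [relS [k [UG uS lk kP]]]]]]] := lg.
have [T [relT uT]] := @ultracoproduct_exists R J E (fun=> S) UE.
have [_ _ ck _ _] := lk.
have [kE kEP] := fibre_map_ultracoproduct UE uT uQ (fun=> ck).
have lkE : ultralevel R a kE by exact: (IHu a ab _ _ _ _ _ _ _ _ _ _ UE uT uQ kEP).
have [V [relV uV]] := @ultracoproduct_exists R _ _ (fun=> Z)
  (@sum_filter_ultra _ E (fun=> K) (fun=> G) UE (fun=> UG)).
have [rel' [uT' relP]] := @ultracoproduct_iterated R J E (fun=> K) (fun=> G)
  (fun _ _ => Z) (fun=> S) (fun=> relS) T relT UE (fun=> UG) (fun=> uS) uT V
  relV uV.
exists {_ : J & K}, (@sum_filter _ E (fun=> K) (fun=> G)), T, rel', (h \o kE).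
split=> //; first exact: sum_filter_ultra.
  exact: (IHc a ab).
apply: (relP _ _ (fun t : {_ : J & S} => g (k (projT2 t)))) => //.
  exact: total_value_continuous.
move=> U z Uz; have [UU _] := ucp_over uT Uz.
by apply: (cvg_continuous_comp _ cg); exact: (hP _ _ (kEP.2 _ _ Uz)).
Qed.

(** The ultracoproduct [Q] of the factorization spaces is an ultracoproduct of copies of the [Y i],
    repeated along [fact_index (t i)]. *)
Lemma iterated_factorization (a : W) (I : Type) (D : set_system I)
    (X Y : I -> topologicalType) (f : forall i, X i -> Y i)
    (t : forall i, factorization (X i) (Y i))
    (Q : topologicalType)
    (relQ : set_system {i & fact_space (t i)} -> Q -> Prop) :
  UltraFilter D -> ultracoproduct R D relQ ->
  (forall i, factorization_of a (f i) (t i)) ->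
  exists rel : set_system {k : {i & fact_index (t i)} & Y (projT1 k)} -> Q -> Prop,
  [/\ UltraFilter (@sum_filter _ D _ (fun i => fact_filter (t i))),
      ultracoproduct R (@sum_filter _ D _ (fun i => fact_filter (t i))) rel &
      forall (K : topologicalType) (c : {i & Y i} -> K) (C : Q -> K),
        compactum K -> fibrewise_continuous c ->
        represents relQ
          (c \o fibre_map f \o fibre_map (fun i => fact_map (t i))) C ->
        represents rel (fun s => c (existT Y (projT1 (projT1 s)) (projT2 s))) C].
Proof.
move=> UD uQ tP.
have UE i : UltraFilter (fact_filter (t i)) by have [] := tP i.
have ut i : ultracoproduct R (fact_filter (t i)) (fact_rel (t i)).
  by have [] := tP i.
have US := @sum_filter_ultra _ D _ (fun i => fact_filter (t i)) UD UE.
have [V [relV uV]] := @ultracoproduct_exists R _ _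
  (fun k : {i & fact_index (t i)} => Y (projT1 k)) US.
have [rel [uQ' relP]] := @ultracoproduct_iterated R I D _
  (fun i => fact_filter (t i)) (fun i _ => Y i) (fun i => fact_space (t i))
  (fun i => fact_rel (t i)) Q relQ UD UE ut uQ V relV uV.
exists rel; split=> // K c C cK cc; apply: relP => //.
move=> i; have [_ _ _ rt] := tP i.
exact: (represents_comp (ut i) (cc i) rt).
Qed.

(** The factorizations of the [f i] glue to [h : Q -> Z], but [F \o h] is an ultracoproduct of
    codiagonals and not a codiagonal of [Z']. A further factorization, of [F \o h] itself, repairs
    this. *)
Lemma level_ultracoproduct_step (b : W) :
  (forall a, (a < b)%O -> level_ultracoproduct_at a) ->
  (forall a, (a < b)%O -> level_comp_at a) ->
  level_ultracoproduct_at b.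
Proof.
move=> IHu IHc I D X Y f Z Z' rel rel' F UD uZ uZ' [cF Frel] lf.
split=> //; [exact: ucp_compactum uZ|exact: ucp_compactum uZ'| |].
  apply: (ultracoproduct_map_surj uZ uZ' _ Frel) => A DA; exists A => //.
  move=> [i y] /= Ai; have [_ _ _ sf _] := lf i.
  have [x _ fx] : range (f i) y by rewrite sf.
  by exists (existT _ i x) => //; rewrite /fibre_map /= fx.
move=> a ab.
have /choice_dep[t tP] := fun i => ultralevel_factorization ab (lf i).
have [Q [relQ uQ]] := @ultracoproduct_exists R I D (fun i => fact_space (t i)) UD.
have lt i : ultralevel R a (fact_map (t i)) by have [] := tP i.
have [h hP] : exists h, lifts_along (fun i => fact_map (t i)) relQ rel h.
  by apply: (fibre_map_ultracoproduct UD uQ uZ) => i; have [] := lt i.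
have lh := IHu a ab _ _ _ _ _ _ _ _ _ _ UD uQ uZ hP lt.
have [rel'' [US uQ' relP]] := iterated_factorization UD uQ tP.
pose pr (s : {k : {i & fact_index (t i)} & Y (projT1 k)}) : {i & Y i} :=
  existT Y (projT1 (projT1 s)) (projT2 s).
have pr_over B : D B ->
    (@sum_filter _ D _ (fun i => fact_filter (t i))) (@projT1 _ _ @^-1` B).
  apply: (@filterS _ D) => i Bi.
  have [UE _ _ _] := tP i.
  by apply: (@filterS _ (fact_filter (t i)) _ setT) => //; exact: filterT.
have [||P cP PP] := ultracoproduct_map uQ' uZ' (f := pr).
- by move=> K c cc k; exact: (cc (projT1 k)).
- by move=> B /pr_over; apply: (@filterS _ _ (@ultra_proper _ _ US)) => k Bk y.
(* [P] is induced by the reindexing [{i & fact_index (t i)} -> I], so it has all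
   levels, and its ultracopower factorization is composed with [h]. *)
have PE : F \o h = P.
  apply/funext => q.
  apply: (compactum_ext (R := R) (ucp_compactum uZ')) => C cC.
  have [c cc cC'] := ucp_lift uZ' cC.
  have cFh : represents rel'' (c \o pr) (C \o (F \o h)).
    apply: relP cc _ => //; first exact: unit_itv_compactum.
    by move=> U z /hP.2/Frel/cC'.
  have cPP : represents rel'' (c \o pr) (C \o P).
    by move=> U z /PP/cC'.
  exact: (congr1 (@^~ q) (represents_inj uQ' (unit_itv_compactum R).2 cFh cPP)).
have lP : ultralevel R b P.
  apply: (reindexing_level hW b US UD uQ' uZ' (phi := @projT1 _ _) (f := pr)) => //.
  split.
    move=> i; have [UE _ _ _] := tP i.
    by have [j _] := filter_ex (@filterT _ (fact_filter (t i)) _); exists (existT _ i j).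
  move=> k; exists id, id; split=> //; by move=> x; exact: cvg_id.
have [_ _ _ _ /(_ a ab)[I' [D' [Q' [relQ' [h' [UD' uQ'' lh' hP']]]]]]] := lP.
exists I', D', Q', relQ', (h \o h'); split=> //; first exact: (IHc a ab).
by rewrite compA PE.
Qed.

Lemma level_ultracoproduct_comp (b : W) :
  level_ultracoproduct_at b /\ level_comp_at b.
Proof.
elim/(well_order_ind hW): b => b IHb.
split; [apply: level_ultracoproduct_step|apply: level_comp_step];
  by move=> a /IHb[].
Qed.

(** The copy of [D] on the points with value [y] has a limit, which [p] sends to [y]. *)
Lemma represents_value_surj (I : Type) (D : set_system I) (Y Q : topologicalType)
    (rel : set_system {i : I & Y} -> Q -> Prop) (p : Q -> Y) :
  UltraFilter D -> hausdorff_space Y -> ultracoproduct R D rel ->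
  represents rel (@total_value I Y) p -> range p = [set: Y].
Proof.
move=> UD hY uQ pP; apply/seteqP; split=> // y _.
have [|z Uz] := ucp_pt uQ (U := (fun i => existT (fun=> Y) i y) @ D).
  by split; [exact: ultra_fmap|].
exists z => //.
have UU := ultra_fmap (fun i => existT (fun=> Y) i y) UD.
apply: (cvg_unique hY (pP _ _ Uz)).
exact: (@cvg_cst _ y _ D).
Qed.

End levels.

(** * Inverse limits *)

Section inverse_limits.
Import ArrowAsProduct.
Context (X : nat -> topologicalType) (f : forall n, X n.+1 -> X n).
Hypothesis cX : forall n, compactum (X n).
Hypothesis cf : forall n, continuous (@f n).

Let L := set_type (inverse_limit f).
Let g n : L -> X n := @inverse_limit_proj X f n.

Lemma inverse_limit_projE n (x : L) : f (g n.+1 x) = g n x.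
Proof. by rewrite /g /inverse_limit_proj -(set_valP x n). Qed.

Lemma inverse_limit_proj_continuous n : continuous (g n).
Proof.
move=> x; apply: (@continuous_comp _ _ _ set_val (@^~ n)).
  exact: set_val_continuous.
exact: (@proj_continuous _ X n).
Qed.

Lemma inverse_limit_proj_inj (x y : L) : (forall n, g n x = g n y) -> x = y.
Proof. by move=> xy; apply: val_inj; apply: functional_extensionality_dep. Qed.

Lemma inverse_limit_factor (S : topologicalType) (u : forall n, S -> X n) :
  (forall n, continuous (u n)) -> (forall n s, f (u n.+1 s) = u n s) ->
  exists2 v : S -> L, continuous v & forall n s, g n (v s) = u n s.
Proof.
move=> cu fu.
have uL s : inverse_limit f (fun n => u n s) by move=> n; rewrite fu.
exists (fun s => SigSub (mem_set (uL s))) => // s.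
have cprod : continuous (fun s => (fun n => u n s) : prod_topology X).
  move=> {}s; apply/cvg_sup => n U [_ [[V oV <-] Vs VU]].
  rewrite /= nbhs_simpl; apply: (@filterS _ (nbhs s) _ _ _ _ (cu n s V _)).
    by move=> t Vt; exact: VU.
  by apply: open_nbhs_nbhs; split.
move=> U [_ [[V oV <-] Vs VU]].
apply: (@filterS _ (nbhs s) _ _ _ _ (cprod s V _)).
  by move=> t Vt; exact: VU.
by apply: open_nbhs_nbhs; split.
Qed.

Lemma inverse_limit_compactum : compactum L.
Proof.
have hP : hausdorff_space (prod_topology X).
  by apply: hausdorff_product => n; exact: (cX n).2.
split; last exact: set_type_hausdorff.
apply: set_type_compact.
have cP : compact [set: prod_topology X].
  have -> : [set: prod_topology X] = [set x | forall n, [set: X n] (x n)].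
    by apply/seteqP; split.
  by apply: (@tychonoff _ X (fun=> setT)) => n; exact: (cX n).1.
apply: subclosed_compact cP _ => //.
move=> x clx n; apply: (cX n).2 => A B xA xB.
have cn m : continuous (fun y : prod_topology X => y m).
  exact: (@proj_continuous _ X m).
have [|y [yL [/= Ay By]]] := clx ((fun y : prod_topology X => y n) @^-1` A `&`
    (fun y : prod_topology X => f (y n.+1)) @^-1` B).
  apply: filterI; first exact: cn.
  apply: (@continuous_comp _ _ _ (fun y : prod_topology X => y n.+1) (@f n)) => //.
  - exact: cn.
  - exact: cf.
by exists (y n); split=> //; rewrite (yL n).
Qed.

End inverse_limits.

(** Induction on [n] shifts the sequence, and [f 0] supplies the missing entry 0. For [n = 0] a
    thread through [x] is obtained by iterating right inverses of the [f m]. *)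
Lemma inverse_limit_proj_surj (n : nat) : forall (X : nat -> topologicalType)
  (f : forall n, X n.+1 -> X n), (forall n, range (f n) = [set: X n]) ->
  range (@inverse_limit_proj X f n) = [set: X n].
Proof.
suff h (X : nat -> topologicalType) (f : forall n, X n.+1 -> X n) :
    (forall n, range (f n) = [set: X n]) ->
    forall x, exists t, inverse_limit f t /\ t n = x.
  move=> X f sf; apply/seteqP; split=> // x _.
  by have [t [Lt tx]] := h X f sf x; exists (SigSub (mem_set Lt)).
elim: n X f => [|n IHn] X f sf x; last first.
  have [t [Lt tx]] := IHn (fun m => X m.+1) (fun m => f m.+1) (fun m => sf m.+1) x.
  exists (fun m => if m is m'.+1 then t m' else f 0%N (t 0%N)); split=> // -[//|m].
  exact: Lt.
have /choice_dep[s sP] : forall m, exists s : X m -> X m.+1, cancel s (f m).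
  move=> m; have /choice[s sE] : forall y : X m, exists z, f m z = y.
    move=> y; have [z _ zy] : range (f m) y by rewrite sf.
    by exists z.
  by exists s.
exists (fix t m := if m is m'.+1 then s m' (t m') else x); split=> // m.
by rewrite /= sP.
Qed.

Lemma cvg_ae_eq (T : Type) (K : topologicalType) (U : set_system T)
    (c c' : T -> K) (k : K) :
  Filter U -> U [set t | c t = c' t] -> c @ U --> k -> c' @ U --> k.
Proof.
move=> FU cc' ck N /ck /= cN.
have : U (c @^-1` N) by [].
by move=> {}cN; apply: (@filterS _ U _ _ _ _ (filterI cc' cN)) => t [/= ->].
Qed.

Section limit_levels.
Context (R : realType) (d : Order.disp_t) (W : orderType d).
Hypothesis hW : wochoice.well_order (fun a b : W => (a <= b)%O).

Lemma inverse_limit_level (b : W) :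
  forall (X : nat -> topologicalType) (f : forall n, X n.+1 -> X n),
  (forall n, ultralevel R b (f n)) ->
  forall n, ultralevel R b (@inverse_limit_proj X f n).
Proof.
elim/(well_order_ind hW): b => b IHb X f lf n.
have cX m : compactum (X m) by have [] := lf m.
have cf m : continuous (f m) by have [] := lf m.
have sf m : range (f m) = setT by have [] := lf m.
pose L : topologicalType := set_type (inverse_limit f).
pose g m : L -> X m := @inverse_limit_proj X f m.
have cL : compactum L := inverse_limit_compactum cX cf.
have cg m : continuous (g m) := @inverse_limit_proj_continuous X f m.
have gE m x : f m (g m.+1 x) = g m x := inverse_limit_projE m x.
have sg m x : exists y, g m y = x.
  have : range (g m) x by rewrite /g inverse_limit_proj_surj.
  by case=> y _ <-; exists y.
split=> //; first exact: inverse_limit_proj_surj.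
move=> a ab.
have lfa m : ultralevel R a (f m) := ultralevel_le (ltW ab) (lf m).
have lg m : ultralevel R a (g m) := IHb a ab X f lfa m.
(* The shift by [n + 1] leaves at least one bonding map from [Y k] down to [X n]. *)
pose Y k := X (k + n).+1.
pose gY k : L -> Y k := g (k + n).+1.
have /choice_dep[dn dnP] : forall k, exists dn : Y k -> X n,
    ultralevel R b dn /\ forall x, dn (gY k x) = g n x.
  elim=> [|k [dn [ldn dnE]]].
    by exists (f n); split=> [|x]; [exact: lf|exact: gE].
  exists (dn \o f (k + n).+1); split.
    exact: (level_ultracoproduct_comp R hW b).2 (lf _) ldn.
  by move=> x; rewrite /= -dnE; congr (dn _); exact: gE.
have /choice_dep[t tP] := fun k => ultralevel_factorization ab (dnP k).1.
(* [E] contains all tails, so any finite number of fibres may be ignored. *)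
have [E [UE Einf]] := ultraFilterLemma eventually_filter.
have Ege m : E [set k | (m <= k)%N] by apply: Einf; exists m.
have [Z [relZ uZ]] := @ultracoproduct_exists R _ E Y UE.
have [ZL [relL uL]] := @ultracoproduct_exists R _ E (fun=> L) UE.
have [Q [relQ uQ]] := @ultracoproduct_exists R _ E (fun k => fact_space (t k)) UE.
have [levu levc] := level_ultracoproduct_comp R hW a.
have [gE' gEP] := fibre_map_ultracoproduct UE uL uZ (fun k => cg (k + n).+1).
have lgE : ultralevel R a gE'.
  by apply: (levu _ _ _ _ _ _ _ _ _ _ UE uL uZ gEP) => k; exact: lg.
have lt k : ultralevel R a (fact_map (t k)) by have [] := tP k.
have [hE hEP] : exists hE, lifts_along (fun k => fact_map (t k)) relQ relZ hE.
  by apply: (fibre_map_ultracoproduct UE uQ uZ) => k; have [] := lt k.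
have lhE : ultralevel R a hE := levu _ _ _ _ _ _ _ _ _ _ UE uQ uZ hEP lt.
have le_map m m' : (m <= m')%N -> exists2 c : X m' -> X m, continuous c &
    forall x, c (g m' x) = g m x.
  elim: m' => [|m' IHm]; rewrite leq_eqVlt => /orP[/eqP <-|//].
  - by exists id => // x; exact: cvg_id.
  - by exists id => // x; exact: cvg_id.
  - move=> /IHm[c cc cE]; exists (c \o f m').
      by move=> x; apply: continuous_comp; [exact: cf|exact: cc].
    by move=> x; rewrite /= gE.
(* Only the fibres with [m <= k + n + 1] matter in the limit; on the other ones
   [c m] is an arbitrary continuous map. *)
have /choice_dep[c cP] : forall m, exists c : {k & Y k} -> X m,
    fibrewise_continuous c /\ forall k, (m <= (k + n).+1)%N ->
      forall x, c (existT Y k (gY k x)) = g m x.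
  move=> m.
  have /choice_dep[c cP] : forall k, exists c : Y k -> X m,
      continuous c /\ ((m <= (k + n).+1)%N -> forall x, c (gY k x) = g m x).
    move=> k; have [/le_map[c cc cE]|mk] := boolP (m <= (k + n).+1)%N.
      by exists c.
    (* An arbitrary map exists: a constant one if [L] is inhabited; otherwise [Y k] is empty because
       [gY k] is surjective. *)
    have [[l]|L0] := pselect (exists l : L, True).
      by exists (fun=> g m l); split=> // x; exact: cvg_cst.
    have Y0 (y : Y k) : False by have [l _] := sg _ y; apply: L0; exists l.
    by exists (fun y => False_rect _ (Y0 y)); split=> // y; case: (Y0 y).
  exists (fun s => c (projT1 s) (projT2 s)); split=> [k|k mk x].
    exact: (cP k).1.
  exact: (cP k).2 mk x.
have /choice_dep[u uP] : forall m, exists u : Z -> X m,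
    continuous u /\ represents relZ (c m) u.
  by move=> m; have [u ? ?] := ucp_lim uZ (cX m) (cP m).1; exists u.
have over_ge U m : lies_over E U -> U [set s : {k & Y k} | (m <= projT1 s)%N].
  by move=> [_ oU]; exact: (oU _ (Ege m)).
have ge_add m k : (m <= k)%N -> (m <= (k + n).+1)%N.
  by move=> mk; rewrite (leq_trans mk)// leqW// leq_addr.
have fu m z : f m (u m.+1 z) = u m z.
  have [U Uz] := ucp_ex uZ z; have oU := ucp_over uZ Uz; have UU := oU.1.
  apply: (cvg_unique (cX m).2 _ ((uP m).2 _ _ Uz)).
  apply: cvg_ae_eq (cvg_continuous_comp _ (cf m) ((uP m.+1).2 _ _ Uz)).
  apply: (@filterS _ U _ _ _ _ (over_ge U m.+1 oU)) => -[k y] /= mk.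
  have [x <-] := sg _ y.
  rewrite (cP m.+1).2 ?(cP m).2 ?gE//; apply: ge_add => //.
  exact: ltnW.
have [v cv vE] := inverse_limit_factor (fun m => (uP m).1) fu.
have [p cp pP] := ucp_lim uL cL (@total_value_continuous nat L).
have vp : v \o gE' = p.
  apply/funext => z; apply: inverse_limit_proj_inj => m.
  rewrite [LHS]vE; have [U Uz] := ucp_ex uL z.
  have [UU oU] := ucp_over uL Uz.
  apply: (cvg_unique (cX m).2 ((uP m).2 _ _ (gEP.2 _ _ Uz))).
  apply: cvg_ae_eq (cvg_continuous_comp _ (cg m) (pP _ _ Uz)).
  apply: (@filterS _ U _ _ _ _ (oU _ (Ege m))) => -[k l] /= mk.
  by rewrite (cP m).2// ge_add.
have sp := represents_value_surj UE cL.2 uL pP.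
have lv : ultralevel R a v.
  split=> //; first exact: ucp_compactum uZ.
    apply/seteqP; split=> // l _; have [z _ <-] : range p l by rewrite sp.
    by exists (gE' z) => //; rewrite -vp.
  (* The single factorization [v \o gE' = p], with [gE'] of level [a], serves every [a' < a]. *)
  move=> a' a'a; exists nat, E, ZL, relL, gE'; split=> //.
    exact: ultralevel_le (ltW a'a) lgE.
  by rewrite vp.
have [rel [US uQ' relP]] := iterated_factorization UE uQ tP.
exists {k & fact_index (t k)}, (@sum_filter _ E _ (fun k => fact_filter (t k))),
  Q, rel, (v \o hE); split=> //; first exact: levc.
apply: (relP _ (fun s : {_ : nat & X n} => projT2 s)) => //.
  exact: total_value_continuous.
move=> U z Uz; have UU := (ucp_over uQ Uz).1.
have := (uP n).2 _ _ (hEP.2 _ _ Uz); rewrite -vE => cvE.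
(* As [n <= k + n + 1] for all [k], no fibre is exceptional: [c n] agrees with [dn k] on all of
   [Y k], since [gY k] is surjective. *)
apply: cvg_ae_eq cvE; apply: (@filterS _ U _ _ _ _ (@filterT _ U _)) => -[k q] _ /=.
rewrite /fibre_map /=; have [x <-] := sg _ (fact_map (t k) q).
by rewrite (cP n).2 ?(dnP k).2// leqW// leq_addl.
Qed.

End limit_levels.

(** * Comparison with the inductive definition of levels *)

Lemma ultracoproduct_homeomorphism (R : realType) (I : Type) (D : set_system I)
    (X : I -> topologicalType) (Z Z' : topologicalType)
    (rel : set_system {i & X i} -> Z -> Prop)
    (rel' : set_system {i & X i} -> Z' -> Prop) :
  UltraFilter D -> ultracoproduct R D rel -> ultracoproduct R D rel' ->
  exists2 F : Z -> Z', homeomorphism F & forall U z, rel U z -> rel' U (F z).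
Proof.
move=> UD uZ uZ'.
have over_id A : D A ->
    D [set i | forall x, A (projT1 (id (existT X i x)))].
  by apply: (@filterS _ D) => i Ai x.
have [//|//|F cF Frel] := ultracoproduct_map uZ uZ' (f := id).
have [//|//|G cG Grel] := ultracoproduct_map uZ' uZ (f := id).
exists F => //; split=> //; exists G => //; split=> z.
- have [U Uz] := ucp_ex uZ z.
  exact: (ucp_rel_inj uZ (Grel _ _ (Frel _ _ Uz)) Uz).
- have [U Uz] := ucp_ex uZ' z.
  exact: (ucp_rel_inj uZ' (Frel _ _ (Grel _ _ Uz)) Uz).
Qed.

Lemma ultracoproduct_transport (R : realType) (I : Type) (D : set_system I)
    (X : I -> topologicalType) (Z Z' : topologicalType)
    (rel : set_system {i & X i} -> Z' -> Prop) (F : Z -> Z') :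
  compactum Z -> homeomorphism F -> ultracoproduct R D rel ->
  ultracoproduct R D (fun U z => rel U (F z)).
Proof.
move=> cZ [cF [G cG [FK GK]]] uZ'; split=> //.
- by move=> U z /(ucp_over uZ').
- by move=> z; have [U] := ucp_ex uZ' (F z); exists U.
- by move=> U /(ucp_pt uZ')[z Uz]; exists (G z); rewrite GK.
- move=> K c cK cc; have [C cC cC'] := ucp_lim uZ' cK cc.
  exists (C \o F); last by move=> U z /cC'.
  by move=> z; apply: continuous_comp; [exact: cF|exact: cC].
- move=> C cC; have [|c cc cC'] := ucp_lift uZ' (C := C \o G).
    by move=> z; apply: continuous_comp; [exact: cG|exact: cC].
  by exists c => // U z /cC'; rewrite /= FK.
Qed.

(** Presents a compactum as the ultracopower of itself over a single index. *)
Definition unit_rel (Y : topologicalType) (U : set_system {_ : unit & Y}) (y : Y) :=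
  lies_over (principal_filter tt) U /\ @total_value unit Y @ U --> y.

Lemma unit_ultracoproduct (R : realType) (Y : topologicalType) : compactum Y ->
  ultracoproduct R (principal_filter tt) (@unit_rel Y).
Proof.
move=> cY; split=> //.
- by move=> U y [].
- move=> y; exists (principal_filter (existT (fun=> Y) tt y)); split.
    split; first exact: principal_filter_ultra.
    by move=> A /principal_filterP Att; apply/principal_filterP.
  move=> N yN; apply/principal_filterP.
  exact: (nbhs_singleton yN).
- move=> U oU.
  have [y Uy] := compactum_ultra_cvg cY (ultra_fmap (@total_value unit Y) oU.1).
  by exists y.
- move=> K c cK cc; exists (fun y => c (existT _ tt y)); first exact: cc.
  move=> U y [[UU _] Uy]; have := cvg_continuous_comp _ (cc tt) Uy.
  have -> : (fun y => c (existT _ tt y)) \o @total_value unit Y = c.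
    by apply/funext => -[[] x].
  by apply.
- move=> C cC; exists (C \o @total_value unit Y); first by move=> i; exact: cC.
  by move=> U y [[UU _] Uy]; exact: cvg_continuous_comp.
Qed.

Section level_comparison.
Context (R : realType) (d : Order.disp_t) (W : orderType d).
Hypothesis hW : wochoice.well_order (fun a b : W => (a <= b)%O).

(* The ultracopower of [Q] along the ultrafilter on a point is [Q] itself. *)
Lemma codiagonal_coelementary (I : Type) (D : set_system I)
    (Y Q : topologicalType) (rel : set_system {i : I & Y} -> Q -> Prop)
    (p : Q -> Y) :
  UltraFilter D -> compactum Y -> ultracoproduct R D rel -> continuous p ->
  represents rel (@total_value I Y) p -> coelementary R p.
Proof.
move=> UD cY uQ cp pP; split=> //.
pose I0 : discreteTopologicalType := discrete_topology unit.
pose J : discreteTopologicalType := discrete_topology {classic I}.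
pose D0 : set_system I0 := principal_filter tt.
pose E : set_system J := D.
have UD0 : UltraFilter D0 by exact: principal_filter_ultra.
have cQ := ucp_compactum uQ.
have [F1 [cF1 [G1 cG1 [F1K G1K]]] F1rel] := ultracoproduct_homeomorphism UD uQ
  (@ultracopower_ultracoproduct R Y J E UD).
have [F2 [cF2 [G2 cG2 [F2K G2K]]] F2rel] := ultracoproduct_homeomorphism UD0
  (unit_ultracoproduct R cQ) (@ultracopower_ultracoproduct R Q I0 D0 UD0).
exists I0, J, D0, E, (F1 \o G2); split=> //.
  split; first by move=> z; apply: continuous_comp; [exact: cG2|exact: cF1].
  exists (F2 \o G1); first by move=> z; apply: continuous_comp; [exact: cG1|exact: cF2].
  by split=> z /=; rewrite ?F1K ?G2K ?F2K ?G1K.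
apply/funext => z /=.
have E1 q : @codiagonal R Q I0 D0 (F2 q) = q.
  have [U Uq] := ucp_ex (unit_ultracoproduct R cQ) q.
  have [[UU _] Uq'] := Uq.
  exact: (cvg_unique cQ.2 (codiagonal_rel cQ (F2rel _ _ Uq)) Uq').
have E2 q : @codiagonal R Y J E (F1 q) = p q.
  have [U Uq] := ucp_ex uQ q; have [UU _] := ucp_over uQ Uq.
  exact: (cvg_unique cY.2 (codiagonal_rel cY (F1rel _ _ Uq)) (pP _ _ Uq)).
by rewrite E2 -[in LHS](G2K z) E1.
Qed.

(** The codiagonal is induced by the reindexing that collapses [I] to a point. *)
Lemma codiagonal_level (b : W) (Z : topologicalType) (I : discreteTopologicalType)
    (D : set_system I) : UltraFilter D -> compactum Z ->
  ultralevel R b (@codiagonal R Z I D).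
Proof.
move=> UD cZ; have uP := @ultracopower_ultracoproduct R Z I D UD.
have uZ := unit_ultracoproduct R cZ.
have pP : represents (@ultracopower_rel R Z I D) (@total_value I Z)
    (@codiagonal R Z I D).
  by move=> U z; exact: codiagonal_rel.
apply: (reindexing_level hW b UD (principal_filter_ultra tt) uP uZ
  (phi := fun=> tt) (f := fun t => existT (fun=> Z) tt (projT2 t))).
- split.
    have [i _] := filter_ex (@filterT _ D _).
    by move=> []; exists i.
  by move=> i; exists id, id; split=> // x; exact: cvg_id.
- move=> B /principal_filterP Btt.
  by apply: (@filterS _ D _ _ _ _ (@filterT _ D _)) => i _.
- exact: (represents_continuous uP cZ (@total_value_continuous I Z) pP).
- move=> U z Uz; have [UU DU] := ucp_over uP Uz; split; last exact: pP Uz.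
  split; first exact: ultra_fmap.
  move=> A /principal_filterP Att.
  by apply: (@filterS _ U _ _ _ _ (@filterT _ U _)) => t _.
Qed.

Lemma zero_succ_limit (b : W) :
  is_zero b \/ (exists a, is_succ a b) \/ is_limit b.
Proof.
have [|nz] := pselect (is_zero b); first by left.
have [|ns] := pselect (exists a, is_succ a b); first by right; left.
by right; right; split=> // a ab; apply: ns; exists a.
Qed.

Lemma exists_succ (a b : W) : (a < b)%O -> exists c, is_succ a c.
Proof.
move=> ab; have [|c [[ac cmin] _]] := @hW [pred c | (a < c)%O].
  by exists b.
by exists c; split=> // c' ac'; exact: cmin.
Qed.

Lemma ultralevel_level_ge (b : W) : forall (X Y : topologicalType) (f : X -> Y),
  ultralevel R b f -> level_ge R b f.
Proof.
elim/(well_order_ind hW): b => b IHb X Y f lf; have [cX cY cf sf fP] := lf.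
have [zb|[[a ab]|lb]] := zero_succ_limit b.
- exact: level_ge_zero.
- have [I [D [Q [rel [h [UD uQ lh hP]]]]]] := fP a ab.1.
  apply: (@level_ge_succ _ _ _ _ _ _ _ a Q (f \o h) h) => //.
  + exact: ucp_compactum uQ.
  + apply: (codiagonal_coelementary UD cY uQ) => //.
    exact: (represents_continuous uQ cY (@total_value_continuous I Y) hP).
  + exact: IHb ab.1 _ _ _ lh.
- apply: level_ge_limit => // a ab; apply: IHb => //.
  exact: ultralevel_le (ltW ab) lf.
Qed.

Lemma level_ge_ultralevel (b : W) : forall (X Y : topologicalType) (f : X -> Y),
  level_ge R b f -> ultralevel R b f.
Proof.
elim/(well_order_ind hW): b => b IHb X Y f [].
- by move=> zb cX cY cf sf; split=> // a; rewrite ltNge zb.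
- move=> a Z g h [ab bmin] cX cY cZ [cg [I [J [D [E [k [UD UE hk gk]]]]]]] lh gE.
  have lh' := IHb a ab _ _ _ lh.
  have [_ _ ch sh _] := lh'.
  have lZ := codiagonal_level a UD cZ.
  have lY := codiagonal_level a UE cY.
  have [cP _ _ _ _] := lZ; have [_ _ _ sY _] := lY.
  have [_ [k' _ [_ k'K]]] := hk.
  split=> //.
  (* [h] is a continuous surjection of compacta, hence a quotient map, so continuity of [g = f \o h]
     passes to [f]. *)
  + apply/continuous_closedP => C cC.
    rewrite (_ : f @^-1` C = h @` (g @^-1` C)).
      apply: compact_closed; first exact: cX.2.
      apply: continuous_compact; first exact/continuous_subspaceT.
      apply: subclosed_compact cZ.1 _ => //.
      exact: ((continuous_closedP g).1 cg).
    apply/seteqP; split=> [x Cx|_ [z Cz <-]].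
      have [z _ zx] : range h x by rewrite sh.
      by exists z => //; rewrite gE /= zx.
    by move: Cz; rewrite gE.
  + apply/seteqP; split=> // y _; have [q _ qy] : range (@codiagonal R Y J E) y.
      by rewrite sY.
    exists (h (@codiagonal R Z I D (k' q))) => //.
    rewrite -qy -[in RHS](k'K q).
    by rewrite -[LHS]/((f \o h) (@codiagonal R Z I D (k' q))) -gE;
       exact: (congr1 (@^~ (k' q)) gk).
  move=> a' a'b.
  have a'a : (a' <= a)%O by rewrite leNgt; apply/negP => /bmin; rewrite leNgt a'b.
  (* Through the homeomorphism [k], the ultracopower of [Z] becomes one of [Y], whose codiagonal is
     [g] after the codiagonal of [Z], that is, [f \o h] after it. *)
  exists J, E, (set_type (@ultracopower R Z I D)),
    (fun U z => ultracopower_rel U (k z)), (h \o @codiagonal R Z I D).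
  split=> //.
  + exact: (ultracoproduct_transport cP hk (@ultracopower_ultracoproduct R Y J E UE)).
  + apply: (ultralevel_le a'a).
    exact: (level_ultracoproduct_comp R hW a).2 lZ lh'.
  + move=> U z /= /(codiagonal_rel cY).
    rewrite -[f (h _)]/((f \o h) _) -gE.
    by have /= -> := congr1 (@^~ z) gk.
- move=> [nz ns] lf.
  have [c cb] : exists c, (c < b)%O.
    apply: contrapT => /forallNP nc; apply: nz => c.
    by rewrite leNgt; apply/negP/nc.
  have [cX cY cf sf _] := IHb c cb _ _ _ (lf c cb).
  (* The successor [s] of [a] is still below the limit [b], and level [s] provides the factorization
     at [a]. *)
  split=> // a ab; have [s as_] := exists_succ ab.
  have sb : (s < b)%O.
    rewrite lt_neqAle as_.2// andbT; apply/eqP => sb.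
    by apply: (ns a); rewrite -sb.
  by have [_ _ _ _ ] := IHb s sb _ _ _ (lf s sb); apply; exact: as_.1.
Qed.

End level_comparison.

Theorem theorem3p4 (R : realType)
    (d : Order.disp_t) (W : orderType d)
    (hW : wochoice.well_order (fun a b : W => (a <= b)%O)) (alpha : W)
    (X : nat -> topologicalType) (hX : forall n : nat, compactum (X n))
    (f : forall n : nat, X n.+1 -> X n)
    (hf : forall n : nat, level_ge R alpha (f n)) :
  forall n : nat, level_ge R alpha (@inverse_limit_proj X f n).
Proof.
move=> n; apply: (ultralevel_level_ge hW).
by apply: (inverse_limit_level hW) => m; exact: (level_ge_ultralevel hW).
Qed.
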